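(* Let $n\ge 2$ and $\ell\in\{1,\dots,\lfloor n/2\rfloor\}$. Then $$\left[1+\frac{1}{2\ell}+\sqrt{1+\frac{1}{4\ell^2}},\,+\infty\right]\subset\Big\{\mu_n(A\mid\ell)_\ell\ :\ A\in\mathfrak{I}_n(\ell,\ell)_\ell\Big\},$$ where the interval on the left contains the value $+\infty$.
   Context: $\mathbb{R}^n$ and $\Lambda^2(\mathbb{R}^n)$ carry their canonical Euclidean norms. **Rational subspaces.** A linear subspace $B$ of $\mathbb{R}^n$ is rational if it has a basis of vectors with rational coordinates; $\mathfrak{R}_n(e)$ is the set of rational subspaces of $\mathbb{R}^n$ of dimension $e$. **Height.** For $B\in\mathfrak{R}_n(e)$, the Plücker coordinates of $B$ are the $\binom{n}{e}$ minors of size $e\times e$ of an $n\times e$ matrix whose columns form a basis of $B$ (well defined up to a nonzero scalar); choosing a representative $\Xi$ with integer coordinates with gcd $1$, set $H(B)=\|\Xi\|$ (Euclidean norm). **Angles.** For nonzero $X,Y\in\mathbb{R}^n$ let $\psi(X,Y)=\|X\wedge Y\|/(\|X\|\,\|Y\|)$ (sine of the angle). For subspaces $A,B$ of dimensions $d,e\ge 1$ and $t=\min(d,e)$, define $\psi_1(A,B),\dots,\psi_t(A,B)$ recursively: $\psi_1(A,B)=\min\psi(X,Y)$ over $X\in A\setminus\{0\}$, $Y\in B\setminus\{0\}$, attained at unit vectors $X_1,Y_1$; given $(X_1,Y_1),\dots,(X_j,Y_j)$, $\psi_{j+1}(A,B)=\min\psi(X,Y)$ over nonzero $X\in A$ orthogonal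 to $X_1,\dots,X_j$ and nonzero $Y\in B$ orthogonal to $Y_1,\dots,Y_j$, attained at unit vectors $X_{j+1},Y_{j+1}$. (These numbers do not depend on the choices.) **Irrationality and exponents.** Let $d,e\in\{1,\dots,n-1\}$ with $d+e\le n$ and $1\le j\le\min(d,e)$. $\mathfrak{I}_n(d,e)_j$ is the set of $d$-dimensional subspaces $A$ of $\mathbb{R}^n$ with $\dim(A\cap B)<j$ for all $B\in\mathfrak{R}_n(e)$. For $A\in\mathfrak{I}_n(d,e)_j$, $\mu_n(A\mid e)_j\in(0,+\infty]$ is the supremum of the $\beta>0$ such that $\psi_j(A,B)\le H(B)^{-\beta}$ for infinitely many $B\in\mathfrak{R}_n(e)$ ($+\infty$ if this set of $\beta$ is unbounded). *)

(* Defs.v *)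
From HB Require Import structures.
From mathcomp Require Import all_boot all_order all_algebra.
From mathcomp Require Import all_classical all_reals all_analysis.

Set Implicit Arguments.
Unset Strict Implicit.
Unset Printing Implicit Defensive.

Import Order.TTheory GRing.Theory Num.Theory.
Local Open Scope classical_set_scope.
Local Open Scope ring_scope.

Section Definitions.
Variables (R : realType) (n : nat).
Notation V := 'rV[R]_n.
Implicit Types (A B : {vspace V}) (X Y : V) (s : seq (V * V)).

Definition dotp X Y : R := \sum_(i < n) X 0 i * Y 0 i.

(* The norm `|X| that the library puts on row vectors is the sup norm. *)
Definition enorm X : R := Num.sqrt (dotp X X).

(* Euclidean norm of X /\ Y in the basis (e_i /\ e_j) with i < j of the second
   exterior power. *)
Definition wedge_norm X Y : R :=
  Num.sqrt (\sum_(i < n) \sum_(j < n | (i < j)%N)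
              (X 0 i * Y 0 j - X 0 j * Y 0 i) ^+ 2).

Definition psi X Y : R := wedge_norm X Y / (enorm X * enorm Y).

Definition rational_subspace B : Prop :=
  exists2 b : seq V, basis_of B b &
    forall v, v \in b -> forall i, exists q : rat, v 0 i = ratr q.

Definition rational_subspaces (e : nat) : set {vspace V} :=
  [set B | rational_subspace B /\ \dim B = e].

(* Increasing maps enumerate the e-element subsets of the n coordinates. *)
Definition minor_index (e : nat) : finType :=
  {f : {ffun 'I_e -> 'I_n} |
    [forall i : 'I_e, forall j : 'I_e, (i < j)%N ==> (f i < f j)%N]}.

(* The basis of B is stored as the rows of M. *)
Definition primitive_plucker B (Xi : {ffun minor_index (\dim B) -> int}) : Prop :=
  (exists (M : 'M[R]_(\dim B, n)) (c : R),
    [/\ basis_of B [tuple row i M | i < \dim B], c != 0 &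
        forall f : minor_index (\dim B),
          \det (colsub (val f) M) = c * (Xi f)%:~R]) /\
  \big[gcdn/0%N]_f `|Xi f|%N = 1%N.

(* For rational B a primitive integral representative exists and is unique up
   to sign, so the norm does not depend on the choice made by xget. *)
Definition height B : R :=
  let Xi := xget 0 [set Xi | @primitive_plucker B Xi] in
  Num.sqrt (\sum_f (Xi f)%:~R ^+ 2).

(* s lists the pairs already chosen. *)
Definition admissible A B s : set (V * V) :=
  [set p | [/\ p.1 \in A, p.1 != 0, p.2 \in B, p.2 != 0 &
    forall q, q \in s -> dotp p.1 q.1 = 0 /\ dotp p.2 q.2 = 0]].

Definition minimizing A B s : set (V * V) :=
  [set p | [/\ admissible A B s p, enorm p.1 = 1, enorm p.2 = 1 &
    forall q, admissible A B s q -> psi p.1 p.2 <= psi q.1 q.2]].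

Fixpoint principal_pairs A B (j : nat) : seq (V * V) :=
  if j is k.+1 then
    let s := principal_pairs A B k in
    rcons s (xget (0, 0) (minimizing A B s))
  else [::].

(* Numbered from 1; meaningful for 1 <= j <= minn (\dim A) (\dim B), where the
   minima are attained and the value does not depend on the chosen pairs. *)
Definition psi_ (j : nat) A B : R :=
  let p := last (0, 0) (principal_pairs A B j) in psi p.1 p.2.

Definition irrational_subspaces (d e j : nat) : set {vspace V} :=
  [set A | \dim A = d /\
    forall B, rational_subspaces e B -> (\dim (A :&: B) < j)%N].

Definition mu (e j : nat) A : \bar R :=
  ereal_sup [set beta%:E | beta in [set beta : R | 0 < beta /\
    infinite_set [set B | rational_subspaces e B /\
                          psi_ j A B <= height B `^ (- beta)]]].

End Definitions.

Arguments irrational_subspaces R n d e j : clear implicits.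

(* Main.v *)
Require Import Defs.
From mathcomp Require Import all_boot all_order all_algebra.
From mathcomp Require Import all_classical all_reals all_analysis.
From mathcomp Require Import fingroup perm.
From mathcomp Require Import zify ring lra.

Set Implicit Arguments.
Unset Strict Implicit.
Unset Printing Implicit Defensive.

Import Order.TTheory GRing.Theory Num.Theory.
Import numFieldNormedType.Exports.
Local Open Scope classical_set_scope.
Local Open Scope ring_scope.

(** Put l = k + 1 and let A be spanned by the plane vector e_0 + alpha e_1 and by
    the coordinate vectors e_2, ..., e_l; this fits in R^n because l + 1 <= n.
    The exponent of A for its last angle with rational subspaces of dimension l
    is the irrationality exponent of alpha.  The left endpoint of the interval
    is at least 2, and each value in [2, +oo] is the irrationality exponent of
    some alpha, so the theorem follows.

    - Numbers alpha with prescribed exponent come from continued fractions whose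
      partial quotients grow at a chosen rate (exists_convergents).

    - The exponent of A is at least that of alpha.  For a fraction p / q close to
      alpha let B be spanned by q e_0 + p e_1, e_2, ..., e_l.  Its height is of
      order q (height_model).  Since A and B share e_2, ..., e_l, the first l - 1
      angles vanish and the last one is at most the angle of the two plane
      vectors, whose sine is at most |alpha - p / q| (psi_model_le).

    - It is at most that of alpha.  If psi_l(A, B) is small, each vector of A is
      close to a vector of B, with error of order psi_l(A, B) (approx_by_psi;
      this uses that the minima defining the angles are attained, by
      compactness).  Hence B has a basis Y close to the model basis of A, and two
      minors of Y are close to 1 and alpha.  Their quotient is a quotient p / q of
      integral Pluecker coordinates of B, with q <= H(B)
      (rational_near_model).  So H(B) ^ (- b) is at most a constant times
      psi_l(A, B) when alpha has exponent b, and only finitely many B have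
      bounded height (northcott). *)

(** * Real numbers with a prescribed irrationality exponent *)
Section Convergents.
Variables (R : realType) (e : nat -> R).
Hypothesis e_ge2 : forall k, 2 <= e k.

(** Two consecutive convergents of the continued fraction
    1 / (a_0 - 1 / (a_1 - 1 / (a_2 - ...))).  The minus signs make the
    convergents increase.  The partial quotient a_k is about q_k ^ (e_k - 2),
    so that q_(k+1) is about q_k ^ (e_k - 1).  The initial pair
    (p_(-1), q_(-1)) = (-1, 0) makes the determinant relation hold from the
    start; the summand 3 makes the denominators at least double. *)
Fixpoint convergent (k : nat) : int * int * int * int :=
  if k is k'.+1 then
    let: (p, q, p', q') := convergent k' in
    let a : int := (3 + Num.truncn (q%:~R `^ (e k' - 2) : R))%N in
    (a * p - p', a * q - q', p, q)
  else (0, 1, -1, 0).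

Definition cnum k : int := (convergent k).1.1.1.
Definition cden k : int := (convergent k).1.1.2.
Definition cquot k : int := (3 + Num.truncn ((cden k)%:~R `^ (e k - 2) : R))%N.

Lemma cnum1 : cnum 1 = 1. Proof. by rewrite /cnum /= mulr0 sub0r opprK. Qed.

Lemma cden1 : cden 1 = cquot 0. Proof. by rewrite /cden /= mulr1 subr0. Qed.

Lemma cnumSS k : cnum k.+2 = cquot k.+1 * cnum k.+1 - cnum k.
Proof.
rewrite /cnum /cquot /cden /=.
by case: (convergent k) => [[[p q] p'] q'].
Qed.

Lemma cdenSS k : cden k.+2 = cquot k.+1 * cden k.+1 - cden k.
Proof.
rewrite /cquot /cden /=.
by case: (convergent k) => [[[p q] p'] q'].
Qed.

Lemma cquot_ge3 k : 3 <= cquot k.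
Proof. by rewrite /cquot; lia. Qed.

Lemma cden_pos_double k : 0 < cden k /\ 2 * cden k <= cden k.+1.
Proof.
elim: k => [|k [IH1 IH2]].
  by rewrite cden1 /cden /=; split=> //; have := cquot_ge3 0; lia.
split; first by lia.
by rewrite cdenSS; have := cquot_ge3 k.+1; nia.
Qed.

Lemma cden_gt0 k : 0 < cden k. Proof. by have [] := cden_pos_double k. Qed.

Lemma cden_double k : 2 * cden k <= cden k.+1.
Proof. by have [] := cden_pos_double k. Qed.

Lemma cden_gt k : (k%:Z < cden k).
Proof. by elim: k => [//|k IH]; have := cden_double k; lia. Qed.

Lemma convergent_det k : cnum k.+1 * cden k = cnum k * cden k.+1 + 1.
Proof.
elim: k => [|k IH]; first by rewrite cnum1 /cnum /cden /=.
rewrite cnumSS cdenSS !mulrBl !mulrBr; move: IH.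
have -> : cquot k.+1 * cnum k.+1 * cden k.+1 = cnum k.+1 * (cquot k.+1 * cden k.+1) by ring.
lia.
Qed.

Lemma cnum_ge0 k : 0 <= cnum k.
Proof.
elim: k => [//|k IH].
by have := convergent_det k; have := cden_gt0 k; have := cden_gt0 k.+1; nia.
Qed.

(** The differences of consecutive numerators have to be compared along with
    the numerators, since the recursion contains a subtraction. *)
Lemma cnum_le_cden k : cnum k <= cden k.
Proof.
have H : cnum k <= cden k - 1 /\ cnum k.+1 - cnum k <= cden k.+1 - cden k.
  elim: k => [|k [IH1 IH2]].
    split=> //; rewrite cnum1 cden1 /cnum /cden /=.
    by have := cquot_ge3 0; lia.
  split; first by lia.
  rewrite cnumSS cdenSS.
  by have := cquot_ge3 k.+1; nia.
by case: H; lia.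
Qed.

Let P k : R := (cnum k)%:~R.
Let Q k : R := (cden k)%:~R.

Lemma cden_ge1r k : 1 <= (cden k)%:~R :> R.
Proof. by rewrite -[1]/(1%:~R) ler_int; have := cden_gt0 k; lia. Qed.

Lemma cden_powR k :
  Q k `^ (e k - 1) <= Q k.+1 /\ Q k.+1 <= 4 * Q k `^ (e k - 1).
Proof.
have Q1 := cden_ge1r k; rewrite -/(Q k) in Q1.
have Q0 : 0 < Q k by lra.
set x := Q k `^ (e k - 2).
have -> : Q k `^ (e k - 1) = x * Q k.
  rewrite (_ : e k - 1 = (e k - 2) + 1); last by ring.
  by rewrite powRD ?powRr1 ?(ltW Q0)//; apply/implyP => _; rewrite gt_eqF.
have x1 : 1 <= x.
  by rewrite -[1](powRr0 (Q k)); apply: ler_powR => //; have := e_ge2 k; lra.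
have x0 : 0 <= x by lra.
have /andP[t1 t2] := truncn_itv x0.
have aE : (cquot k)%:~R = 3 + (Num.truncn x)%:R :> R.
  by rewrite /cquot -/(Q k) -/x -pmulrn natrD.
case: k @x Q1 Q0 x1 x0 t1 t2 aE => [|k] x Q1 Q0 x1 x0 t1 t2 aE.
  rewrite [Q 1]/Q cden1 aE; have -> : Q 0 = 1 by [].
  by move: t1 t2; rewrite -natr1; split; lra.
have QQ : Q k.+2 = (3 + (Num.truncn x)%:R) * Q k.+1 - Q k.
  by rewrite /Q cdenSS rmorphB rmorphM /= aE.
have Qk : 2 * Q k <= Q k.+1.
  by rewrite /Q -[2]/(2%:~R) -intrM ler_int cden_double.
have Qk1 := cden_ge1r k; rewrite -/(Q k) in Qk1.
by move: t1 t2; rewrite QQ -natr1; split; nra.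
Qed.

Let x k : R := P k / Q k.

Lemma convergent_ltS k : x k.+1 = x k + 1 / (Q k * Q k.+1).
Proof.
have Q1 := cden_ge1r k; have Q2 := cden_ge1r k.+1.
have D : P k.+1 * Q k = P k * Q k.+1 + 1.
  by rewrite /P /Q -!intrM convergent_det intrD.
rewrite /x -/(Q k) -/(Q k.+1) in Q1 Q2 *.
have -> : P k.+1 / Q k.+1 = (P k.+1 * Q k) / (Q k * Q k.+1) by field; lra.
by rewrite D; field; lra.
Qed.

Lemma convergent_homo j k : (j <= k)%N -> x j <= x k.
Proof.
move=> /subnK <-; elim: (k - j)%N => [//|m IH]; rewrite addSn convergent_ltS.
apply: le_trans IH _; rewrite lerDl divr_ge0// mulr_ge0//.
- by have := cden_ge1r (m + j); rewrite -/(Q _); lra.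
- by have := cden_ge1r (m + j).+1; rewrite -/(Q _); lra.
Qed.

(** The gaps 1 / (q_k q_(k+1)) at least halve at each step, so the numbers
    x_k + 2 / (q_k q_(k+1)) decrease and bound all convergents from above. *)
Lemma convergent_upper j k : x j <= x k + 2 / (Q k * Q k.+1).
Proof.
have QQ m : 0 < Q m by have := cden_ge1r m; rewrite -/(Q _); lra.
have tail m : x (m + k)%N + 2 / (Q (m + k)%N * Q (m + k).+1)
              <= x k + 2 / (Q k * Q k.+1).
  elim: m => [//|m IH]; apply: le_trans IH; rewrite addSn.
  set i := (m + k)%N; rewrite convergent_ltS -addrA lerD2l.
  have D : 2 * Q i.+1 <= Q i.+2.
    by rewrite /Q -[2]/(2%:~R) -intrM ler_int cden_double.
  have D' : 2 * Q i <= Q i.+1.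
    by rewrite /Q -[2]/(2%:~R) -intrM ler_int cden_double.
  rewrite -subr_ge0.
  have -> : 2 / (Q i * Q i.+1) - (1 / (Q i * Q i.+1) + 2 / (Q i.+1 * Q i.+2))
     = (Q i.+2 - 2 * Q i) / (Q i * Q i.+1 * Q i.+2).
    by field; rewrite !gt_eqF ?QQ.
  rewrite divr_ge0//; last by rewrite ltW// !mulr_gt0 ?QQ.
  by have := QQ i; lra.
case/orP: (leq_total j k) => [jk|/subnK <-].
  apply: le_trans (convergent_homo jk) _.
  by rewrite lerDl divr_ge0 ?mulr_ge0 ?(ltW (QQ _)).
apply: le_trans (tail (j - k)%N).
by rewrite lerDl divr_ge0 ?mulr_ge0 ?(ltW (QQ _)).
Qed.

Definition climit : R := sup (range x).

Lemma climit_bounds k :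
  1 / (Q k * Q k.+1) <= climit - x k <= 2 / (Q k * Q k.+1).
Proof.
have ub : has_sup (range x).
  split; first by exists (x 0), 0%N.
  by exists (x 0 + 2 / (Q 0 * Q 1)) => _ [j _ <-]; exact: convergent_upper.
apply/andP; split.
  rewrite lerBrDl -convergent_ltS; apply: ub_le_sup; first by case: ub.
  by exists k.+1.
rewrite lerBlDl; apply: ge_sup; first by case: ub.
by move=> _ [j _ <-]; exact: convergent_upper.
Qed.

Lemma climit_gt k : x k < climit.
Proof.
have /andP[+ _] := climit_bounds k.
have Q1 := cden_ge1r k; have Q2 := cden_ge1r k.+1; rewrite -/(Q _) in Q1 Q2.
have : 0 < 1 / (Q k * Q k.+1) by rewrite divr_gt0// mulr_gt0//; lra.
lra.
Qed.

Lemma climit_itv01 : 0 <= climit <= 1.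
Proof.
have /andP[h1 h2] := climit_bounds 0.
have x0 : x 0 = 0 by rewrite /x /P /cnum /= mul0r.
have Q0 : Q 0 = 1 by [].
have Q1 : 2 <= Q 1.
  by rewrite /Q -[2]/(2%:~R) ler_int; have := cden_double 0.
move: h1 h2; rewrite x0 Q0 !mul1r subr0 => h1 h2; apply/andP; split.
  by apply: le_trans h1; rewrite invr_ge0; lra.
by apply: le_trans h2 _; rewrite ler_pdivrMr ?mul1r//; lra.
Qed.

Lemma rat_dist (p q p' q' : int) : 0 < q -> 0 < q' -> p * q' != p' * q ->
  1 / (q%:~R * q'%:~R) <= `|p%:~R / q%:~R - p'%:~R / q'%:~R| :> R.
Proof.
move=> q0 q'0 N.
have qr : 0 < q%:~R :> R by rewrite ltr0z.
have q'r : 0 < q'%:~R :> R by rewrite ltr0z.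
have -> : p%:~R / q%:~R - p'%:~R / q'%:~R =
    (p * q' - p' * q)%:~R / (q%:~R * q'%:~R) :> R.
  by rewrite intrD rmorphN !intrM; field; rewrite !gt_eqF.
rewrite normrM normfV (gtr0_norm (mulr_gt0 qr q'r)) ler_pM2r ?invr_gt0 ?mulr_gt0//.
rewrite -intr_norm -[1]/(1%:~R) ler_int; lia.
Qed.

(** Distinct fractions with denominators q and q_k differ by at least
    1 / (q q_k), and q_(k+1) >= 4 q forces the limit to lie within half of
    that distance of the convergent. *)
Lemma climit_other_rat (p q : int) k : 0 < q -> 4 * q <= cden k.+1 ->
  p * cden k != cnum k * q ->
  1 / (2 * q%:~R * Q k) <= `|climit - p%:~R / q%:~R|.
Proof.
move=> q0 qk N.
have := rat_dist q0 (cden_gt0 k) N; rewrite -/(P k) -/(Q k) -/(x k).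
have /andP[_ +] := climit_bounds k; have := climit_gt k.
have qr : 0 < q%:~R :> R by rewrite ltr0z.
have Q0 : 0 < Q k by rewrite ltr0z cden_gt0.
have Q1 : 0 < Q k.+1 by rewrite ltr0z cden_gt0.
have : 2 / (Q k * Q k.+1) <= 1 / (2 * q%:~R * Q k).
  rewrite ler_pdivrMr ?mulr_gt0// mulrAC ler_pdivlMr ?mulr_gt0//.
  have : 4 * q%:~R <= Q k.+1 by rewrite -[4]/(4%:~R) -intrM ler_int.
  by nra.
have -> : 1 / (q%:~R * Q k) = 1 / (2 * q%:~R * Q k) + 1 / (2 * q%:~R * Q k).
  by field; rewrite !gt_eqF.
move=> h1 h2 h3 h4.
have := ler_distD climit (p%:~R / q%:~R) (x k).
rewrite (distrC _ climit) (gtr0_norm (_ : 0 < climit - x k)) ?subr_gt0//.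
lra.
Qed.

Lemma climit_irrational (p q : int) : 0 < q -> climit != p%:~R / q%:~R.
Proof.
move=> q0; apply/eqP => E.
set k := `|(4 * q)%R|%N.
have qk : 4 * q <= cden k.+1 by have := cden_gt k.+1; rewrite /k; lia.
have [N|N] := eqVneq (p * cden k) (cnum k * q); last first.
  have := climit_other_rat q0 qk N; rewrite -E subrr normr0.
  rewrite leNgt divr_gt0 ?mulr_gt0 ?ltr0z//; exact: cden_gt0.
have := climit_gt k; rewrite E /x.
have qr : 0 < q%:~R :> R by rewrite ltr0z.
have Q0 : 0 < Q k by rewrite ltr0z cden_gt0.
by rewrite ltr_pdivrMr// mulrAC ltr_pdivlMr// /P /Q -!intrM N ltxx.
Qed.

Lemma climit_approx k : `|climit - x k| <= 2 * Q k `^ (- e k).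
Proof.
rewrite gtr0_norm ?subr_gt0 ?climit_gt//.
have /andP[_ +] := climit_bounds k; move=> /le_trans; apply.
have Q0 : 0 < Q k by rewrite ltr0z cden_gt0.
have Q1 : 0 < Q k.+1 by rewrite ltr0z cden_gt0.
rewrite ler_pM2l// powRN lef_pV2 ?posrE ?mulr_gt0 ?powR_gt0//.
rewrite -(mulr_powRB1 (ltW Q0)); last by have := e_ge2 k; lra.
by rewrite ler_pM2l//; have [] := cden_powR k.
Qed.

(** Take the first k with 4 q <= q_(k+1), so that q_k <= 4 q.  A fraction other
    than the k-th convergent is at distance at least 1 / (8 q^2) by
    climit_other_rat, and b >= 2.  The k-th convergent is in lowest terms by
    the determinant relation, so q >= q_k, and its distance to the limit is at
    least 1 / (q_k q_(k+1)), which is of order q_k ^ (- b). *)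
Lemma climit_badly_approx (b : R) (eb : forall k, e k = b) (p q : int) :
  0 < q -> 1 / 8 * q%:~R `^ (- b) <= `|climit - p%:~R / q%:~R|.
Proof.
move=> q0.
have qr : 1 <= q%:~R :> R by rewrite -[1]/(1%:~R) ler_int.
have b2 : 2 <= b by rewrite -(eb 0); exact: e_ge2.
have ex : exists k, 4 * q <= cden k.+1.
  by exists `|(4 * q)%R|%N; have := cden_gt (`|(4 * q)%R|%N).+1; lia.
pose k := ex_minn ex.
have [qk kmin] : 4 * q <= cden k.+1 /\ forall j, 4 * q <= cden j.+1 -> (k <= j)%N.
  by rewrite /k; case: ex_minnP.
have Qk4 : Q k <= 4 * q%:~R.
  rewrite /Q -[4]/(4%:~R) -intrM ler_int.
  case: (k) kmin => [|j] kmin; first by rewrite /cden /=; lia.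
  rewrite leNgt; apply/negP => h.
  by have := kmin j (ltW h); rewrite ltnn.
have Q0 : 0 < Q k by rewrite ltr0z cden_gt0.
have Q1 : 0 < Q k.+1 by rewrite ltr0z cden_gt0.
have [N|N] := eqVneq (p * cden k) (cnum k * q); last first.
  apply: le_trans (climit_other_rat q0 qk N).
  rewrite powRN ler_pdivlMr ?mulr_gt0//; last by lra.
  have : q%:~R ^+ 2 <= q%:~R `^ b :> R by rewrite -powR_mulrn ?ler_powR//; lra.
  set y := _ `^ b => qy; have y0 : 0 < y by nra.
  rewrite -(ler_pM2r y0) [1 * y]mul1r.
  have -> : 1 / 8 * y^-1 * (2 * q%:~R * Q k) * y = 1 / 8 * (2 * q%:~R * Q k).
    by field; rewrite gt_eqF.
  by nra.
have -> : p%:~R / q%:~R = x k.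
  have N' : p%:~R * Q k = P k * q%:~R by rewrite /P /Q -!intrM N.
  have qn : q%:~R != 0 :> R by rewrite gt_eqF//; lra.
  have Qn : Q k != 0 by rewrite gt_eqF.
  by apply: (mulIf Qn); apply: (mulIf qn); rewrite /x !mulfVK// mulrAC mulfVK.
have Qq : Q k <= q%:~R.
  rewrite ler_int.
  (* The determinant relation exhibits q as a multiple of q_k. *)
  have D : q = cden k * (cnum k.+1 * q - cden k.+1 * p).
    rewrite mulrBr; have := convergent_det k.
    have -> : cden k * (cden k.+1 * p) = cden k.+1 * (p * cden k) by ring.
    rewrite N => Det; rewrite -[LHS]mul1r.
    rewrite (_ : 1 = cnum k.+1 * cden k - cnum k * cden k.+1); first by ring.
    by rewrite Det; ring.
  have t0 : 0 < cnum k.+1 * q - cden k.+1 * p.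
    by move: q0; rewrite {1}D pmulr_rgt0// cden_gt0.
  by rewrite D ler_peMr ?(ltW (cden_gt0 k))//; lia.
have [_ up] := cden_powR k; rewrite eb in up.
rewrite gtr0_norm ?subr_gt0 ?climit_gt//.
have /andP[low _] := climit_bounds k; apply: le_trans low.
rewrite ler_pdivlMr ?mulr_gt0//.
have h : Q k * Q k.+1 <= 4 * Q k `^ b.
  rewrite -(mulr_powRB1 (ltW Q0)) ?(mulrCA 4) ?ler_pM2l//; lra.
have h' : Q k `^ b <= q%:~R `^ b by apply: ge0_ler_powR; rewrite ?nnegrE//; lra.
have y0 : 0 < q%:~R `^ b :> R by apply: powR_gt0; lra.
rewrite powRN mulrAC ler_pdivrMr//; lra.
Qed.

Lemma convergent_lt j k : (j < k)%N -> x j < x k.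
Proof.
move=> /convergent_homo; apply: lt_le_trans; rewrite convergent_ltS ltrDl.
by rewrite divr_gt0 ?mulr_gt0 ?ltr0z ?cden_gt0.
Qed.

End Convergents.

(** Constant e gives irrationality exponent exactly e; unbounded e gives a
    Liouville number. *)
Lemma exists_convergents (R : realType) (e : nat -> R) : (forall k, 2 <= e k) ->
  exists (alpha : R) (p q : nat -> int),
  [/\ 0 <= alpha <= 1,
      forall a b : int, 0 < b -> alpha != a%:~R / b%:~R,
      forall k, [/\ k%:Z < q k, 0 <= p k <= q k
                  & `|alpha - (p k)%:~R / (q k)%:~R| <= 2 * (q k)%:~R `^ (- e k)],
      forall j k, (j < k)%N -> (p j)%:~R / (q j)%:~R < (p k)%:~R / (q k)%:~R :> R
    & forall b, (forall k, e k = b) -> forall a c : int, 0 < c ->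
        1 / 8 * c%:~R `^ (- b) <= `|alpha - a%:~R / c%:~R|].
Proof.
move=> e2; exists (climit e), (cnum e), (cden e); split.
- exact: climit_itv01.
- exact: climit_irrational.
- move=> k; rewrite cden_gt cnum_ge0 cnum_le_cden; split=> //.
  exact: climit_approx.
- exact: convergent_lt.
- exact: climit_badly_approx.
Qed.

(** * Euclidean geometry of row vectors *)
Section Euclidean.
Variables (R : realType) (n : nat).
Notation V := 'rV[R]_n.
Implicit Types (A B U : {vspace V}) (X Y Z : V).

Lemma dotpC X Y : dotp X Y = dotp Y X.
Proof. by apply: eq_bigr => i _; rewrite mulrC. Qed.

Lemma dotp_mx X Y : dotp X Y = (X *m Y^T) 0 0.
Proof. by rewrite mxE; apply: eq_bigr => i _; rewrite mxE. Qed.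

Lemma dotpDl X Y Z : dotp (X + Y) Z = dotp X Z + dotp Y Z.
Proof. by rewrite !dotp_mx mulmxDl mxE. Qed.

Lemma dotpZl a X Y : dotp (a *: X) Y = a * dotp X Y.
Proof. by rewrite !dotp_mx -scalemxAl mxE. Qed.

Lemma dotpBl X Y Z : dotp (X - Y) Z = dotp X Z - dotp Y Z.
Proof. by rewrite dotpDl -scaleN1r dotpZl mulN1r. Qed.

Lemma dotpZr a X Y : dotp Y (a *: X) = a * dotp Y X.
Proof. by rewrite dotpC dotpZl dotpC. Qed.

Lemma dotpBr X Y Z : dotp Z (X - Y) = dotp Z X - dotp Z Y.
Proof. by rewrite dotpC dotpBl !(dotpC _ Z). Qed.

Lemma dotp_suml (I : finType) (k : I -> R) (F : I -> V) Y :
  dotp (\sum_i k i *: F i) Y = \sum_i k i * dotp (F i) Y.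
Proof.
rewrite dotp_mx mulmx_suml summxE; apply: eq_bigr => i _.
by rewrite -dotp_mx dotpZl.
Qed.

Lemma dotp_ge0 X : 0 <= dotp X X.
Proof. by apply: sumr_ge0 => i _; rewrite -expr2 sqr_ge0. Qed.

Lemma dotp_eq0 X : (dotp X X == 0) = (X == 0).
Proof.
apply/eqP/eqP => [/eqP|->]; last by apply: big1 => i _; rewrite mxE mul0r.
rewrite psumr_eq0; last by move=> i _; rewrite -expr2 sqr_ge0.
move/allP => H; apply/rowP => i; rewrite mxE; apply/eqP.
by have := H i (mem_index_enum i); rewrite -expr2 sqrf_eq0.
Qed.

Lemma sqr_enorm X : enorm X ^+ 2 = dotp X X.
Proof. by rewrite /enorm sqr_sqrtr// dotp_ge0. Qed.

Lemma enorm_gt0 X : (0 < enorm X) = (X != 0).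
Proof. by rewrite /enorm sqrtr_gt0 lt_neqAle dotp_ge0 andbT eq_sym dotp_eq0. Qed.

Lemma enorm1_dotp X : enorm X = 1 -> dotp X X = 1.
Proof. by rewrite -sqr_enorm => ->; rewrite expr1n. Qed.

Lemma enormZ a X : enorm (a *: X) = `|a| * enorm X.
Proof.
by rewrite /enorm dotpZl dotpZr mulrA -expr2 sqrtrM ?sqr_ge0// sqrtr_sqr.
Qed.

Lemma enorm_normalize X : X != 0 -> enorm ((enorm X)^-1 *: X) = 1.
Proof.
rewrite -enorm_gt0 => X0; rewrite enormZ ger0_norm ?invr_ge0 ?(ltW X0)//.
by rewrite mulVf// gt_eqF.
Qed.

Lemma coord_le_enorm X i : `|X 0 i| <= enorm X.
Proof.
rewrite -sqrtr_sqr /enorm ler_sqrt ?dotp_ge0// /dotp (bigD1 i)//= -expr2 lerDl.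
by apply: sumr_ge0 => j _; rewrite -expr2 sqr_ge0.
Qed.

(** Summing over all ordered pairs (i, j) instead of i < j doubles the left-hand
    side and makes the double sum factor. *)
Lemma lagrange_identity X Y :
  \sum_(i < n) \sum_(j < n | (i < j)%N) (X 0 i * Y 0 j - X 0 j * Y 0 i) ^+ 2
  = dotp X X * dotp Y Y - dotp X Y ^+ 2.
Proof.
pose F i j := (X 0 i * Y 0 j - X 0 j * Y 0 i) ^+ 2.
set S := LHS.
have S1 : S = \sum_(i < n) \sum_(j < n | (j < i)%N) F i j.
  rewrite /S (exchange_big_dep predT)//=; apply: eq_bigr => j _.
  by apply: eq_bigr => i _; rewrite /F; ring.
have S2 : \sum_(i < n) \sum_(j < n) F i j = S + S.
  rewrite {2}S1 -big_split; apply: eq_bigr => i _ /=.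
  rewrite (bigID (fun j : 'I_n => (i < j)%N))/=; congr (_ + _).
  rewrite big_mkcond [RHS]big_mkcond; apply: eq_bigr => j _ /=.
  by rewrite -leqNgt leq_eqVlt; case: eqP => [/val_inj ->|//] /=;
     rewrite ltnn /F subrr expr0n.
have S3 : \sum_(i < n) \sum_(j < n) F i j = 2 * (dotp X X * dotp Y Y - dotp X Y ^+ 2).
  transitivity (\sum_(i < n) \sum_(j < n) (X 0 i * X 0 i * (Y 0 j * Y 0 j)
     + Y 0 i * Y 0 i * (X 0 j * X 0 j) - 2 * (X 0 i * Y 0 i * (X 0 j * Y 0 j)))).
    by apply: eq_bigr => i _; apply: eq_bigr => j _; rewrite /F; ring.
  under eq_bigr do rewrite sumrB big_split/= -!mulr_sumr.
  rewrite sumrB big_split/= -!mulr_suml -mulr_sumr -mulr_suml /dotp; ring.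
by have : 2 * S = 2 * (dotp X X * dotp Y Y - dotp X Y ^+ 2); [rewrite -S3 S2; ring|lra].
Qed.

Lemma wedge_normE X Y :
  wedge_norm X Y = Num.sqrt (dotp X X * dotp Y Y - dotp X Y ^+ 2).
Proof. by rewrite /wedge_norm lagrange_identity. Qed.

Lemma cauchy_schwarz X Y : `|dotp X Y| <= enorm X * enorm Y.
Proof.
rewrite -sqrtr_sqr /enorm -sqrtrM ?dotp_ge0//; apply: ler_wsqrtr.
rewrite -subr_ge0 -lagrange_identity; apply: sumr_ge0 => i _.
by apply: sumr_ge0 => j _; exact: sqr_ge0.
Qed.

Lemma psi_ge0 X Y : 0 <= psi X Y.
Proof. by rewrite divr_ge0 ?mulr_ge0 ?sqrtr_ge0. Qed.

Lemma psi_diag X : psi X X = 0.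
Proof. by rewrite /psi wedge_normE expr2 subrr sqrtr0 mul0r. Qed.

Lemma psiZ a b X Y : a != 0 -> b != 0 -> psi (a *: X) (b *: Y) = psi X Y.
Proof.
move=> a0 b0; rewrite /psi !wedge_normE !enormZ !dotpZl !dotpZr.
have -> : a * (a * dotp X X) * (b * (b * dotp Y Y)) - (a * (b * dotp X Y)) ^+ 2
  = (a * b) ^+ 2 * (dotp X X * dotp Y Y - dotp X Y ^+ 2) by ring.
rewrite sqrtrM ?sqr_ge0// sqrtr_sqr normrM.
rewrite -(mulrACA `|a| `|b|) invfM mulrACA mulfV ?mul1r//.
by rewrite mulf_neq0 ?normr_eq0.
Qed.

(** For unit vectors psi is the distance from X to the line of Y, which turns
    angles into coordinatewise approximation. *)
Lemma unit_residual X Y : enorm X = 1 -> enorm Y = 1 ->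
  enorm (X - dotp X Y *: Y) = psi X Y.
Proof.
move=> X1 Y1; rewrite /psi X1 Y1 mulr1 divr1 wedge_normE /enorm; congr Num.sqrt.
rewrite !(dotpBl, dotpBr, dotpZl, dotpZr) (dotpC Y X).
by rewrite (enorm1_dotp X1) (enorm1_dotp Y1); ring.
Qed.

Lemma continuous_dotp (T : topologicalType) (f g : T -> V) :
  continuous f -> continuous g -> continuous (fun t => dotp (f t) (g t)).
Proof.
move=> cf cg; apply: continuous_big => [|i _ t].
  by move=> z; exact: add_continuous.
apply: continuousM.
  exact: (continuous_comp (cf t) (@coord_continuous R 1 n 0 i (f t))).
exact: (continuous_comp (cg t) (@coord_continuous R 1 n 0 i (g t))).
Qed.

(** The equations are the coordinates of the linear map that sends X to its
    projection on A minus X; they show that A is closed. *)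
Lemma subspace_equations A :
  exists W : 'I_n -> V, forall X, X \in A <-> forall k, dotp X (W k) = 0.
Proof.
pose W k : V := \row_i ((projv A (delta_mx 0 i) - delta_mx 0 i) 0 k).
have WE X k : dotp X (W k) = (projv A X - X) 0 k.
  rewrite [in RHS](row_sum_delta X) linear_sum -sumrB summxE.
  by apply: eq_bigr => i _; rewrite linearZ/= -scalerBr [RHS]mxE [W k 0 i]mxE.
exists W => X; split=> [XA k|H].
  by rewrite WE projv_id// subrr mxE.
have -> : X = projv A X; last exact: memv_proj.
by apply/esym/eqP; rewrite -subr_eq0; apply/eqP/rowP => k; rewrite -WE H mxE.
Qed.

Lemma compact_unit_sphere A (s : seq V) :
  compact [set X | [/\ X \in A, enorm X = 1 & forall y, y \in s -> dotp X y = 0]].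
Proof.
have [W HW] := subspace_equations A.
apply: bounded_closed_compact.
  exists 1; split=> // M M1 X [_ X1 _].
  rewrite /= [leLHS]/Num.Def.normr/= mx_normrE bigmax_le//=; first by lra.
  move=> [i j] _ /=; rewrite ord1 (le_trans (coord_le_enorm X j))// X1; lra.
have cl0 (y : V) : closed [set X : V | dotp X y = 0].
  rewrite (_ : [set X : V | _] = (fun X : V => dotp X y) @^-1` [set 0])//.
  apply: preimage_closed _ (@closed_eq _ _).
  move=> t _; apply: continuous_dotp => z; first exact: cvg_id.
  exact: (@cst_continuous V V y z).
rewrite (_ : [set X | _] =
   (\bigcap_(k in [set: 'I_n]) [set X : V | dotp X (W k) = 0]) `&`
   ([set X : V | dotp X X = 1] `&` \bigcap_(y in [set` s]) [set X : V | dotp X y = 0])).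
  apply: closedI; first by apply: closed_bigI => k _; exact: cl0.
  apply: closedI; last by apply: closed_bigI => y _; exact: cl0.
  rewrite (_ : [set X : V | _] = (fun X : V => dotp X X) @^-1` [set 1])//.
  apply: preimage_closed _ (@closed_eq _ _).
  by move=> t _; apply: continuous_dotp => // z; exact: cvg_id.
apply/seteqP; split=> X /=.
  move=> [/HW XA X1 Xs]; split; first by move=> k _; exact: XA.
  by split; [exact: enorm1_dotp | move=> y ys; exact: Xs].
move=> [XA [X1 Xs]]; split; last by move=> y ys; exact: Xs.
  by apply/HW => k; exact: XA.
by rewrite /enorm X1 sqrtr1.
Qed.

End Euclidean.

(** * Principal pairs of two subspaces *)
Section PrincipalPairs.
Variables (R : realType) (n : nat).
Notation V := 'rV[R]_n.
Implicit Types (A B U : {vspace V}) (X Y Z : V) (s : seq (V * V)).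

(** psi is invariant under scaling, so it is enough to minimise over pairs of
    unit vectors.  On these minimising psi amounts to maximising the square of
    the inner product, and the admissible pairs form a product of two compact
    sets because the constraints on X and on Y are separate. *)
Lemma minimizing_nonempty A B s :
  admissible A B s !=set0 -> minimizing A B s !=set0.
Proof.
move=> [p0 [Ap0 p0A Bp0 p0B orth0]].
pose sphere (U : {vspace V}) (t : seq V) :=
  [set X | [/\ X \in U, enorm X = 1 & forall y, y \in t -> dotp X y = 0]].
pose KA := sphere A [seq q.1 | q <- s]; pose KB := sphere B [seq q.2 | q <- s].
have normal (U : {vspace V}) (t : seq V) X : X \in U -> X != 0 ->
    (forall y, y \in t -> dotp X y = 0) -> sphere U t ((enorm X)^-1 *: X).
  move=> XU X0 Xt; split; first by rewrite memvZ.
    exact: enorm_normalize.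
  by move=> y /Xt; rewrite dotpZl => ->; rewrite mulr0.
have cK : compact (KA `*` KB) by apply: compact_setX; exact: compact_unit_sphere.
have inK p : admissible A B s p ->
    (KA `*` KB) ((enorm p.1)^-1 *: p.1, (enorm p.2)^-1 *: p.2).
  move=> [pA p10 pB p20 orth]; split=> /=; apply: normal => // _ /mapP[q qs ->].
    by have [] := orth q qs.
  by have [] := orth q qs.
pose f (p : V * V) : R := - (dotp p.1 p.2 * dotp p.1 p.2).
have cf : continuous f.
  have cd : continuous (fun p : V * V => dotp p.1 p.2).
    by apply: continuous_dotp => q; [exact: cvg_fst|exact: cvg_snd].
  by move=> p; apply: cvgN; apply: cvgM; exact: cd.
have [||c cK0 cmin] := @compact_EVT_min _ R f (KA `*` KB) _ cK.
- by exists ((enorm p0.1)^-1 *: p0.1, (enorm p0.2)^-1 *: p0.2); exact: inK.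
- exact: continuous_subspaceT.
have [[c1A c11 c1o] [c2B c21 c2o]] := set_mem cK0.
exists c; split=> //.
  split=> //; first by rewrite -enorm_gt0 c11.
    by rewrite -enorm_gt0 c21.
  by move=> q qs; rewrite c1o ?c2o//; apply/mapP; exists q.
move=> q qad; have [[q1A q11 _] [q2B q21 _]] := inK _ qad.
have [_ q10 _ q20 _] := qad.
rewrite -(@psiZ _ _ (enorm q.1)^-1 (enorm q.2)^-1 q.1) ?invr_eq0 ?gt_eqF ?enorm_gt0//.
have := cmin _ (mem_set (inK _ qad)); rewrite /f/= lerN2 => le_dotp.
rewrite /psi !wedge_normE c11 c21 q11 q21 mulr1 !divr1 !enorm1_dotp//.
by apply: ler_wsqrtr; rewrite lerB// !expr2.
Qed.

Lemma orthogonal_in_subspace U (t : seq V) : (size t < \dim U)%N ->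
  exists X, [/\ X \in U, X != 0 & forall y, y \in t -> dotp X y = 0].
Proof.
move=> tU; pose M : 'M[R]_(n, size t) := \matrix_(k, i) t`_i 0 k.
pose f : 'Hom(V, 'rV[R]_(size t)) := linfun (mulmxr M).
have : (0 < \dim (U :&: lker f))%N.
  have le_im : (\dim (f @: U) <= size t)%N.
    by have := dimvS (subvf (f @: U)%VS); rewrite dimvf dim_matrix; rewrite -[leqRHS]/(1 * size t)%N mul1n.
  rewrite -(ltn_add2r (\dim (f @: U))) add0n limg_ker_dim.
  exact: leq_ltn_trans le_im tU.
rewrite lt0n dimv_eq0 -vpick0 => X0.
exists (vpick (U :&: lker f)%VS).
have /memv_capP[XU] := memv_pick (U :&: lker f)%VS.
rewrite memv_ker lfunE/= => /eqP/rowP XM.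
split=> // y /(nthP 0)[i it <-].
have := XM (Ordinal it); rewrite !mxE => <-.
by apply: eq_bigr => k _; rewrite mxE.
Qed.

Lemma size_principal_pairs A B j : size (principal_pairs A B j) = j.
Proof. by elim: j => [//|j IH] /=; rewrite size_rcons IH. Qed.

Lemma principal_pairsS_minimizing A B j : (j < \dim A)%N -> (j < \dim B)%N ->
  let s := principal_pairs A B j in
  minimizing A B s (xget (0, 0) (minimizing A B s)).
Proof.
move=> jA jB s; apply: xgetPex; apply: minimizing_nonempty.
have ss : size s = j by exact: size_principal_pairs.
have [|X [XA X0 Xo]] := @orthogonal_in_subspace A [seq q.1 | q <- s].
  by rewrite size_map ss.
have [|Y [YB Y0 Yo]] := @orthogonal_in_subspace B [seq q.2 | q <- s].
  by rewrite size_map ss.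
exists (X, Y); split=> // q qs; split; [apply: Xo|apply: Yo]; exact: map_f.
Qed.

(** The next pair was already admissible at the previous stage. *)
Lemma psi_leS A B j : (j.+1 < \dim A)%N -> (j.+1 < \dim B)%N ->
  psi_ j.+1 A B <= psi_ j.+2 A B.
Proof.
move=> jA jB; rewrite /psi_.
have := principal_pairsS_minimizing jA jB.
have := principal_pairsS_minimizing (ltnW jA) (ltnW jB).
rewrite [principal_pairs A B j.+2]/= [principal_pairs A B j.+1]/= !last_rcons /=.
set s := principal_pairs A B j; set m := xget _ (minimizing A B s).
set m' := xget _ _ => -[_ _ _ mmin] [[m'A m'1 m'B m'2 m'o] _ _ _].
apply: mmin; split=> // q qs; apply: m'o; by rewrite mem_rcons inE qs orbT.
Qed.

Lemma principal_pairs_spec A B j : (j <= \dim A)%N -> (j <= \dim B)%N ->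
  let s := principal_pairs A B j in
  (forall p, p \in s -> [/\ p.1 \in A, p.2 \in B, enorm p.1 = 1, enorm p.2 = 1
                         & psi p.1 p.2 <= psi_ j A B]) /\
  pairwise [rel p q | dotp p.1 q.1 == 0] s.
Proof.
elim: j => [//|j IH] jA jB s.
have [IH1 IH2] := IH (ltnW jA) (ltnW jB).
have := principal_pairsS_minimizing jA jB.
rewrite /s [principal_pairs A B j.+1]/=; set t := principal_pairs A B j in IH1 IH2 *.
set m := xget _ _ => -[[mA m1 mB m2 mo] em1 em2 mmin].
have psim : psi_ j.+1 A B = psi m.1 m.2 by rewrite /psi_ /= last_rcons.
split=> [p|]; last first.
  rewrite pairwise_rcons IH2 andbT; apply/allP => q qt /=.
  by rewrite dotpC; apply/eqP; have [] := mo q qt.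
rewrite mem_rcons inE => /orP[/eqP ->|pt]; first by rewrite psim.
have [pA pB p1 p2 pp] := IH1 p pt; split=> //; apply: le_trans pp _.
case: (j) jA jB @t pt {IH IH1 IH2 s m mA m1 mB m2 mo em1 em2 mmin psim} => [//|i iA iB t _].
exact: psi_leS.
Qed.

(** The first components X_i of the principal pairs form an orthonormal basis
    of A.  Write X in this basis and replace each X_i by its projection on the
    line of Y_i; by unit_residual each replacement costs at most
    psi_i <= psi_l. *)
Lemma approx_by_psi A B l : \dim A = l -> \dim B = l ->
  forall X, X \in A -> exists2 Y, Y \in B &
    forall i, `|X 0 i - Y 0 i| <= l%:R * enorm X * psi_ l A B.
Proof.
move=> dA dB X XA.
have [] := @principal_pairs_spec A B l; rewrite ?dA ?dB//.
set s := principal_pairs A B l => sP sO.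
have ss : size s = l by exact: size_principal_pairs.
pose x (i : 'I_l) : V := (nth (0, 0) s i).1.
pose y (i : 'I_l) : V := (nth (0, 0) s i).2.
have ins (i : 'I_l) : nth (0, 0) s i \in s by rewrite mem_nth// ss.
have xx i k : dotp (x i) (x k) = (i == k)%:R.
  have [<-|ik] := eqVneq i k.
    by apply: enorm1_dotp; have [] := sP _ (ins i).
  move/(pairwiseP (0, 0)): sO => sO.
  wlog : i k ik / (i < k)%N => [W|lt_ik].
    case: (ltngtP i k) => [| |/val_inj E]; [exact: W| |by rewrite E eqxx in ik].
    by rewrite dotpC; apply: W; rewrite eq_sym.
  by apply/eqP; apply: sO; rewrite // inE ss.
pose xs := [tuple x i | i < l].
have xn (i : 'I_l) : xs`_i = x i by rewrite -tnth_nth tnth_mktuple.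
have coefE (k : 'I_l -> R) i : dotp (\sum_j k j *: x j) (x i) = k i.
  rewrite dotp_suml (bigD1 i)//= xx eqxx mulr1 big1 ?addr0 // => a ai.
  by rewrite xx (negPf ai) mulr0.
have xB : basis_of A xs.
  rewrite basisEfree size_tuple dA leqnn andbT; apply/andP; split.
    apply/freeP => k k0 i; rewrite -(coefE k i).
    under eq_bigr do rewrite -xn.
    by rewrite k0 -(scale0r 0) dotpZl mul0r.
  by apply/span_subvP => _ /mapP[i _ ->]; have [] := sP _ (ins i).
have XE : X = \sum_i dotp X (x i) *: x i.
  rewrite {1}(coord_basis xB XA); apply: eq_bigr => i _.
  rewrite xn {2}(coord_basis xB XA); under [in RHS]eq_bigr do rewrite xn.
  by rewrite coefE.
exists (\sum_i (dotp X (x i) * dotp (x i) (y i)) *: y i).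
  by apply: memv_suml => i _; rewrite memvZ//; have [] := sP _ (ins i).
move=> k.
have -> : X 0 k - (\sum_i (dotp X (x i) * dotp (x i) (y i)) *: y i) 0 k
  = \sum_i dotp X (x i) * (x i - dotp (x i) (y i) *: y i) 0 k.
  rewrite {1}XE !summxE -sumrB; apply: eq_bigr => i _.
  by rewrite !mxE; ring.
apply: le_trans (ler_norm_sum _ _ _) _.
rewrite -[l in l%:R]card_ord -mulrA mulr_natl -sumr_const; apply: ler_sum => i _.
have [xA yB x1 y1 xy] := sP _ (ins i).
rewrite normrM ler_pM//.
  by rewrite -[leRHS]mulr1 -x1; exact: cauchy_schwarz.
by apply: le_trans (coord_le_enorm _ _) _; rewrite unit_residual.
Qed.

End PrincipalPairs.

(** * Minors and Pluecker coordinates *)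
Section Minors.
Variables (R : realType) (n : nat).
Notation V := 'rV[R]_n.
Implicit Types (A B U : {vspace V}) (d : nat).

(** The predicate primitive_plucker with the dimension as an independent
    parameter; for d = \dim B the two are convertible. *)
Definition is_plucker d B (Xi : {ffun minor_index n d -> int}) : Prop :=
  (exists (M : 'M[R]_(d, n)) (c : R),
    [/\ basis_of B [tuple row i M | i < d], c != 0 &
        forall f : minor_index n d, \det (colsub (val f) M) = c * (Xi f)%:~R]) /\
  \big[gcdn/0%N]_f `|Xi f|%N = 1%N.

Lemma injective_sort d (g : 'I_d -> 'I_n) : injective g ->
  exists (f : minor_index n d) (s : {perm 'I_d}), forall i, g i = val f (s i).
Proof.
move=> gI; pose le : rel 'I_n := relpre val leq.
have st : size (sort le (codom g)) == d.
  by rewrite size_sort size_codom card_ord.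
pose t : d.-tuple 'I_n := Tuple st.
have /tuple_permP[s sE] : perm_eq (codom g) t by rewrite perm_sym perm_sort.
have incr (i j : 'I_d) : (i < j)%N -> (tnth t i < tnth t j)%N.
  move=> ij; have t0 : 'I_n by exact: (g i).
  have ut : uniq t by rewrite sort_uniq map_inj_uniq ?enum_uniq.
  have so : sorted ltn (map val t).
    rewrite ltn_sorted_uniq_leq map_inj_uniq ?ut//=; last exact: val_inj.
    rewrite sorted_map; apply: sort_sorted => a b; exact: leq_total.
  have := sorted_ltn_nth ltn_trans 0%N so.
  move/(_ i j); rewrite !inE size_map size_tuple => /(_ (ltn_ord i) (ltn_ord j) ij).
  by rewrite !(nth_map t0) ?size_tuple// -!tnth_nth.
have fP : [forall i : 'I_d, forall j : 'I_d,
    (i < j)%N ==> ([ffun i => tnth t i] i < [ffun i => tnth t i] j)%N].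
  apply/forallP => i; apply/forallP => j; apply/implyP => ij.
  by rewrite !ffunE; exact: incr.
exists (Sub [ffun i => tnth t i] fP), s => i.
have := congr1 (fun c => nth (g i) c i) sE.
rewrite codomE (nth_map i) ?size_enum_ord// nth_ord_enum => ->.
by rewrite -tnth_nth tnth_mktuple SubK ffunE.
Qed.

Lemma det_colsub_perm d (f : 'I_d -> 'I_n) (s : {perm 'I_d}) (M : 'M[R]_(d, n)) :
  \det (colsub (f \o s) M) = (-1) ^+ s * \det (colsub f M).
Proof.
have -> : colsub (f \o s) M = col_perm s (colsub f M).
  by apply/matrixP => i j; rewrite !mxE.
by rewrite col_permE det_mulmx det_perm odd_permV mulrC.
Qed.

(** A minor along an arbitrary map of column indices is zero if the map is not
    injective, and otherwise is an increasing minor up to the sign of the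
    sorting permutation. *)
Lemma minors_proportional d (M M' : 'M[R]_(d, n)) (k : R) :
  (forall f : minor_index n d,
     \det (colsub (val f) M) = k * \det (colsub (val f) M')) ->
  forall g : 'I_d -> 'I_n, \det (colsub g M) = k * \det (colsub g M').
Proof.
move=> H g; have [/injectiveP gI|/injectivePn[i [j ij gij]]] := boolP (injectiveb g).
  have [f [s gs]] := injective_sort gI.
  rewrite !(eq_colsub _ (gs : g =1 val f \o s)) !det_colsub_perm H.
  by rewrite mulrCA.
have det0 (N : 'M[R]_(d, n)) : \det (colsub g N) = 0.
  rewrite -det_tr; apply: (determinant_alternate ij) => a.
  by rewrite !mxE gij.
by rewrite !det0 mulr0.
Qed.

Lemma span_rowsP d (M : 'M[R]_(d, n)) v :
  reflect (exists u : 'rV_d, v = u *m M) (v \in <<[tuple row i M | i < d]>>%VS).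
Proof.
have E (u : 'rV[R]_d) :
    u *m M = \sum_(i < d) u 0 i *: [tuple row i M | i < d]`_i.
  rewrite mulmx_sum_row; apply: eq_bigr => i _.
  by rewrite -tnth_nth tnth_mktuple.
apply: (iffP idP) => [vM|[u ->]].
  exists (\row_i coord [tuple row i M | i < d] i v).
  rewrite E {1}(coord_span vM); apply: eq_bigr => i _.
  by rewrite mxE.
rewrite E; apply: memv_suml => i _; apply: memvZ; apply: memv_span.
by rewrite mem_nth// size_tuple.
Qed.

Lemma free_rows d (M : 'M[R]_(d, n)) :
  (forall u : 'rV_d, u *m M = 0 -> u = 0) -> free [tuple row i M | i < d].
Proof.
move=> H; apply/freeP => k k0 i.
have /H/rowP/(_ i) : (\row_i k i) *m M = 0.
  rewrite mulmx_sum_row -[RHS]k0; apply: eq_bigr => j _.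
  by rewrite mxE -tnth_nth tnth_mktuple.
by rewrite !mxE.
Qed.

Lemma minor_free d (M : 'M[R]_(d, n)) (g : 'I_d -> 'I_n) :
  \det (colsub g M) != 0 -> free [tuple row i M | i < d].
Proof.
move=> D0; apply: free_rows => u u0.
have U : colsub g M \in unitmx by rewrite unitmxE unitfE.
rewrite -[u](mulmxK U) mulmx_colsub u0.
by apply/rowP => j; rewrite !mxE big1// => i _; rewrite !mxE mul0r.
Qed.

Lemma free_minor d (M : 'M[R]_(d, n)) : free [tuple row i M | i < d] ->
  exists f : minor_index n d, \det (colsub (val f) M) != 0.
Proof.
move=> /freeP F.
have rf : row_full M^T.
  rewrite /row_full mxrank_tr -/(row_free M); apply: inj_row_free => v vM.
  apply/rowP => i; rewrite mxE; apply: (F (v 0)).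
  rewrite -[RHS]vM mulmx_sum_row; apply: eq_bigr => j _.
  by rewrite -tnth_nth tnth_mktuple.
have U := fullrowsub_unit rf.
have [f [s fs]] := injective_sort (@fullrankfun_inj _ _ _ _ rf).
exists f; apply: contraTneq U => D0.
rewrite unitmxE unitfE -det_tr.
have -> : (rowsub (fullrankfun rf) M^T)^T = colsub (val f \o s) M.
  by apply/matrixP => i j; rewrite !mxE fs.
by rewrite det_colsub_perm D0 mulr0 eqxx.
Qed.

Lemma basis_rows_factor d B (M : 'M[R]_(d, n)) e (Y : 'M[R]_(e, n)) :
  basis_of B [tuple row i M | i < d] -> (forall i, row i Y \in B) ->
  exists T : 'M[R]_(e, d), Y = T *m M.
Proof.
move=> /span_basis BM YB.
have /choice[t tE] : forall i, exists u : 'rV_d, row i Y = u *m M.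
  by move=> i; apply/span_rowsP; rewrite BM.
exists (\matrix_i t i); apply/row_matrixP => i.
by rewrite tE row_mul rowK.
Qed.

(** When the columns selected by f form the identity, replacing the i-th of them
    by column j yields a matrix whose row i has its only nonzero entry N i j on
    the diagonal. *)
Lemma normal_form_entry d (N : 'M[R]_(d, n)) (f : 'I_d -> 'I_n) i j :
  colsub f N = 1%:M ->
  N i j = \det (colsub (fun a => if a == i then j else f a) N).
Proof.
move=> N1; set C := colsub _ N.
have Nf a b : N a (f b) = (a == b)%:R.
  by have /matrixP/(_ a b) := N1; rewrite !mxE.
rewrite (expand_det_row _ i) (bigD1 i)//= big1 => [|b bi]; last first.
  by rewrite mxE (negPf bi) Nf eq_sym (negPf bi) mul0r.
rewrite addr0 mxE eqxx /cofactor addnn -signr_odd odd_double mul1r.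
rewrite (_ : row' i (col' i C) = 1%:M) ?det1 ?mulr1//.
apply/matrixP => a b; rewrite !mxE eq_sym (negPf (neq_lift i b)) Nf.
by rewrite (inj_eq (@lift_inj _ i)).
Qed.

(** Normalise both bases so that a fixed nonzero minor becomes the identity
    block.  All entries are then quotients of minors by normal_form_entry, and
    these quotients depend only on Xi; so the normalised bases coincide. *)
Lemma plucker_injective d B B' (Xi : {ffun minor_index n d -> int}) :
  is_plucker B Xi -> is_plucker B' Xi -> B = B'.
Proof.
suff sub U U' : is_plucker U Xi -> is_plucker U' Xi -> (U <= U')%VS.
  by move=> H H'; apply/eqP; rewrite eqEsubv !sub.
move=> [[M [c [Mb c0 Mm]]] _] [[M' [c' [Mb' c0' Mm']]] _].
pose k := c / c'.
have k0 : k != 0 by rewrite mulf_neq0 ?invr_eq0.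
have kM (g : 'I_d -> 'I_n) : \det (colsub g M) = k * \det (colsub g M').
  apply: minors_proportional => f.
  by rewrite Mm Mm' mulrA /k divfK.
have [f0 D0] := free_minor (basis_free Mb).
have D0' : \det (colsub (val f0) M') != 0.
  by move: D0; rewrite kM mulf_eq0 negb_or => /andP[].
set W := colsub (val f0) M in D0; set W' := colsub (val f0) M' in D0'.
have UW : W \in unitmx by rewrite unitmxE unitfE.
have UW' : W' \in unitmx by rewrite unitmxE unitfE.
have NN : invmx W *m M = invmx W' *m M'.
  apply/matrixP => i j.
  rewrite !(@normal_form_entry _ _ (val f0)) -?mulmx_colsub ?mulVmx//.
  rewrite !det_mulmx !det_inv !kM -/W -/W'.
  by rewrite invfM mulrACA mulVf ?mul1r.
rewrite -(span_basis Mb) -(span_basis Mb'); apply/subvP => v /span_rowsP[u ->].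
apply/span_rowsP; exists (u *m W *m invmx W').
by rewrite -!mulmxA -NN !mulmxA mulmxK.
Qed.

End Minors.

(** * Height of rational subspaces *)
Section Height.
Variables (R : realType) (n : nat).
Notation V := 'rV[R]_n.
Implicit Types (A B U : {vspace V}) (d : nat).

Lemma rat_common_denominator (I : finType) (m : I -> rat) :
  exists (D : int) (z : I -> int), D != 0 /\ forall i, (z i)%:~R = D%:~R * m i.
Proof.
exists (\prod_i denq (m i)).
exists (fun i => numq (m i) * \prod_(j | j != i) denq (m j)).
split=> [|i]; first by apply/prodf_neq0 => i _; exact: denq_neq0.
by rewrite [in RHS](bigD1 i)//= !intrM numqE; ring.
Qed.

Lemma primitive_multiple (I : finType) (z : I -> int) i0 : z i0 != 0 ->
  exists (G : nat) (x : I -> int), [/\ G != 0%N, forall i, z i = G%:Z * x i &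
     \big[gcdn/0%N]_i `|x i|%N = 1%N].
Proof.
move=> z0; pose G := \big[gcdn/0%N]_i `|z i|%N.
have Gz i : (G %| `|z i|)%N by apply: biggcdn_inf (dvdnn _).
have G0 : G != 0%N.
  by apply: contraTneq (Gz i0) => ->; rewrite dvd0n absz_eq0.
have zE i : z i = G%:Z * (z i %/ G%:Z)%Z by rewrite mulrC divzK// dvdzE.
exists G, (fun i => (z i %/ G%:Z)%Z); split=> //.
apply/eqP; rewrite -dvdn1; set g := bigop _ _ _.
rewrite -(@dvdn_pmul2l G) ?lt0n// muln1.
suff : (G * g %| \big[gcdn/0%N]_i `|z i|)%N by [].
apply/dvdn_biggcdP => i _; rewrite [X in (_ %| `|X|)%N](zE i) abszM dvdn_mul//.
by apply: biggcdn_inf (dvdnn _).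
Qed.

(** The vectors x and N are proportional, so x_i divides N_i x_j for all j,
    hence divides N_i times the gcd of the x_j, which is N_i. *)
Lemma proportional_le_primitive (I : finType) (x N : I -> int) (c : R) :
  \big[gcdn/0%N]_i `|x i|%N = 1%N -> c != 0 ->
  (forall i, (N i)%:~R = c * (x i)%:~R) -> forall i, `|x i| <= `|N i|.
Proof.
move=> x1 c0 Nx i; have [->|xi0] := eqVneq (x i) 0; first by rewrite normr0.
have cross j : N i * x j = N j * x i.
  by apply: (@intr_inj R); rewrite !intrM !Nx mulrAC.
have Ni0 : N i != 0 by rewrite -(intr_eq0 R) Nx mulf_neq0// intr_eq0.
have dv : (`|x i| %| `|N i|)%N.
  rewrite -[X in (_ %| X)%N]muln1 -x1.
  rewrite (big_morph (muln `|N i|%N) (muln_gcdr _) (muln0 _)).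
  apply/dvdn_biggcdP => j _.
  by rewrite -abszM cross abszM dvdn_mull.
by rewrite -!abszE lez_nat dvdn_leq// absz_gt0.
Qed.

(** The minors of a rational basis are rational and not all zero: clear their
    denominators and divide by the gcd. *)
Lemma rational_plucker d B : rational_subspace B -> \dim B = d ->
  exists Xi : {ffun minor_index n d -> int}, is_plucker B Xi.
Proof.
move=> [b bB brat] dB; have sb : size b = d.
  by rewrite -dB (size_basis (bB : basis_of B (in_tuple b))).
pose M : 'M[R]_(d, n) := \matrix_(i, j) b`_i 0 j.
have Mb : basis_of B [tuple row i M | i < d].
  rewrite (_ : tval _ = b)//; apply: (@eq_from_nth _ 0) => [|i]; rewrite size_tuple ?sb//.
  move=> id; rewrite -(tnth_nth 0 _ (Ordinal id)) tnth_mktuple.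
  by apply/rowP => j; rewrite !mxE.
have /choice[Mq MqE] : forall p : 'I_d * 'I_n, exists q : rat, M p.1 p.2 = ratr q.
  by move=> [i j]; rewrite mxE; apply: brat; rewrite mem_nth// sb.
have minorE (f : minor_index n d) :
    \det (colsub (val f) M) = ratr (\det (colsub (val f) (\matrix_(i, j) Mq (i, j)))).
  rewrite -det_map_mx; congr (\det _); apply/matrixP => i j.
  by rewrite mxE (MqE (i, val f j)) !mxE.
have [D [z [D0 zE]]] := rat_common_denominator
  (fun f : minor_index n d => \det (colsub (val f) (\matrix_(i, j) Mq (i, j)))).
have zM f : (z f)%:~R = D%:~R * \det (colsub (val f) M).
  by rewrite minorE -(ratr_int _ D) -rmorphM/= -zE ratr_int.
have [f0 f00] := free_minor (basis_free Mb).
have zf0 : z f0 != 0 by rewrite -(intr_eq0 R) zM mulf_neq0// intr_eq0.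
have [G [x [G0 zx x1]]] := primitive_multiple zf0.
exists [ffun f => x f]; split; last by rewrite -[RHS]x1; apply: eq_bigr => f _; rewrite ffunE.
exists M, (G%:R / D%:~R); split=> // [|f].
  by rewrite mulf_neq0 ?invr_eq0 ?intr_eq0// pnatr_eq0.
apply: (@mulfI _ D%:~R); first by rewrite intr_eq0.
by rewrite -zM zx ffunE intrM mulrA mulrCA divff ?mulr1// intr_eq0.
Qed.

Lemma height_spec d B : rational_subspace B -> \dim B = d ->
  exists2 Xi : {ffun minor_index n d -> int},
    is_plucker B Xi & height B = Num.sqrt (\sum_f (Xi f)%:~R ^+ 2).
Proof.
move=> rB dB; subst d.
exists (xget 0 [set Xi | primitive_plucker (B := B) Xi]); last by [].
exact: xgetPex (rational_plucker rB erefl).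
Qed.

Lemma coord_le_l2norm (I : finType) (x : I -> R) i :
  `|x i| <= Num.sqrt (\sum_j x j ^+ 2).
Proof.
rewrite -sqrtr_sqr ler_wsqrtr// (bigD1 i)//= lerDl.
by apply: sumr_ge0 => j _; exact: sqr_ge0.
Qed.

Lemma height_ge1 B : rational_subspace B -> 1 <= height B.
Proof.
move=> rB; have [Xi [_ x1] ->] := height_spec rB erefl.
have [f f0] : exists f, Xi f != 0.
  apply/existsP; apply: contraPT x1; rewrite negb_exists => /forallP H.
  rewrite big1// => f _; have := H f; rewrite negbK => /eqP ->.
  by rewrite absz0.
apply: le_trans (coord_le_l2norm (fun f => (Xi f)%:~R) f).
by rewrite -intr_norm -[1]/(1%:~R) ler_int; lia.
Qed.

(** Primitive Pluecker coordinates are the smallest integral ones, so any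
    basis with integral minors gives an upper bound. *)
Lemma height_le_integral d B (M : 'M[R]_(d, n)) (N : minor_index n d -> int) (K : R) :
  rational_subspace B -> basis_of B [tuple row i M | i < d] ->
  (forall f : minor_index n d, \det (colsub (val f) M) = (N f)%:~R) ->
  0 <= K -> (forall f, `|(N f)%:~R| <= K) ->
  height B <= Num.sqrt #|minor_index n d|%:R * K.
Proof.
move=> rB Mb MN K0 NK.
have [Xi [[M' [c [Mb' c0 Mm']]] x1] ->] := height_spec rB (size_basis Mb).
have [T MT] : exists T, M = T *m M'.
  apply: basis_rows_factor Mb' _ => i; apply: (basis_mem Mb).
  by apply/mapP; exists i => //; rewrite mem_enum.
have NE f : (N f)%:~R = \det T * c * (Xi f)%:~R.
  by rewrite -MN MT -mulmx_colsub det_mulmx Mm' mulrA.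
have [f0 f00] := free_minor (basis_free Mb).
have T0 : \det T * c != 0.
  by apply: contraNneq f00; rewrite MN NE => ->; rewrite mul0r.
have XN := proportional_le_primitive x1 T0 NE.
rewrite -(ger0_norm K0) -sqrtr_sqr -sqrtrM ?ler0n//; apply: ler_wsqrtr.
rewrite mulr_natl -sumr_const; apply: ler_sum => f _.
rewrite -real_normK ?num_real// -[K ^+ 2]real_normK ?num_real//.
rewrite lerXn2r ?nnegrE// (ger0_norm K0) (le_trans _ (NK f))//.
by rewrite -!intr_norm ler_int.
Qed.

(** Bounded height leaves finitely many integral Pluecker vectors, and each of
    them determines the subspace. *)
Lemma northcott d (K : R) :
  finite_set [set B : {vspace V} | rational_subspaces d B /\ height B <= K].
Proof.
pose N := (Num.truncn K).+1.
pose F (phi : {ffun minor_index n d -> 'I_(N + N)}) : {ffun minor_index n d -> int} :=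
  [ffun f => (val (phi f))%:Z - N%:Z].
apply: (@sub_finite_set _ _ (\bigcup_(Xi in range F) [set B | is_plucker B Xi])).
  move=> B [[rB dB] HK]; have [Xi XiP hE] := height_spec rB dB.
  exists Xi => //.
  have XN f : - N%:Z <= Xi f < N%:Z.
    have : `|(Xi f)%:~R| < N%:R :> R.
      apply: le_lt_trans (coord_le_l2norm (fun f => (Xi f)%:~R) f) _.
      by rewrite -hE (le_lt_trans HK)// truncnS_gt.
    rewrite ltr_norml => /andP[h1 h2]; apply/andP; split.
      by rewrite ltW// -(ltr_int R) rmorphN.
    by rewrite -(ltr_int R).
  have XO f : (`|(Xi f + N%:Z)%R| < N + N)%N by have := XN f; lia.
  exists [ffun f => Ordinal (XO f)] => //.
  apply/ffunP => f; rewrite /F !ffunE; apply: (canLR (addrK N%:Z)).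
  by apply: gez0_abs; have /andP[] := XN f; lia.
apply: bigcup_finite; first exact/finite_image/finite_finset.
move=> Xi _; have [[B HB]|H] := pselect (exists B : {vspace V}, is_plucker B Xi).
  apply: (@sub_finite_set _ _ [set B]); last exact: finite_set1.
  by move=> B' HB'; exact: plucker_injective HB' HB.
rewrite (_ : [set _ | _] = set0)//.
by apply/seteqP; split=> // B HB; apply: H; exists B.
Qed.

End Height.

(** * Principal pairs of subspaces with a large intersection *)
Section SharedSubspace.
Variables (R : realType) (n : nat).
Notation V := 'rV[R]_n.
Implicit Types (A B : {vspace V}) (u v w : V).

(** As long as fewer than \dim (A :&: B) pairs have been chosen, some vector Z of
    the intersection is orthogonal to all of them and (Z, Z) has angle zero; so
    the minimum is zero, and the chosen vectors are proportional and belong to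
    the intersection. *)
Lemma principal_pairs_common A B j : (j <= \dim (A :&: B))%N ->
  forall p, p \in principal_pairs A B j ->
  [/\ p.1 \in (A :&: B)%VS, p.2 \in (A :&: B)%VS & exists2 c, c != 0 & p.1 = c *: p.2].
Proof.
elim: j => [//|j IH] jAB; have {}IH := IH (ltnW jAB).
have jA := leq_trans jAB (dimvS (capvSl A B)).
have jB := leq_trans jAB (dimvS (capvSr A B)).
have := principal_pairsS_minimizing jA jB; cbv zeta.
rewrite [principal_pairs A B j.+1]/=; set s := principal_pairs A B j in IH *.
set m := xget _ _ => -[[mA m10 mB m20 _] em1 em2 mmin] p.
rewrite mem_rcons inE => /orP[/eqP ->|]; last exact: IH.
have [|Z [ZAB Z0 Zo]] := @orthogonal_in_subspace _ _ (A :&: B)%VS [seq q.1 | q <- s].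
  by rewrite size_map size_principal_pairs.
have /memv_capP[ZA ZB] := ZAB.
have Zad : admissible A B s (Z, Z).
  split=> // q qs; have Zq1 : dotp Z q.1 = 0 by apply: Zo; exact: map_f.
  split=> //; have [_ _ [c c0 qc]] := IH q qs.
  by move: Zq1; rewrite qc dotpZr => /eqP; rewrite mulf_eq0 (negPf c0) => /eqP.
have psi0 : psi m.1 m.2 = 0.
  by apply/eqP; rewrite eq_le psi_ge0 andbT -(psi_diag Z); exact: mmin Zad.
have mE : m.1 = dotp m.1 m.2 *: m.2.
  apply/eqP; rewrite -subr_eq0 -[_ == _]negbK -enorm_gt0.
  by rewrite (unit_residual em1 em2) psi0 ltxx.
have c0 : dotp m.1 m.2 != 0.
  by apply: contraNneq m10 => c0; rewrite mE c0 scale0r.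
have m1B : m.1 \in B by rewrite mE memvZ.
have m2A : m.2 \in A.
  by rewrite -[m.2]scale1r -(mulVf c0) -scalerA -mE memvZ.
by split; [apply/memv_capP|apply/memv_capP|exists (dotp m.1 m.2)].
Qed.

(** The first j pairs lie in the intersection by principal_pairs_common, hence
    (u, w) is admissible at stage j.+1. *)
Lemma psi_le_orthogonal_cap A B j u w :
  (j <= \dim (A :&: B))%N -> (j < \dim A)%N -> (j < \dim B)%N ->
  u \in A -> w \in B -> u != 0 -> w != 0 ->
  (forall v, v \in (A :&: B)%VS -> dotp v u = 0 /\ dotp v w = 0) ->
  psi_ j.+1 A B <= psi u w.
Proof.
move=> jAB jA jB uA wB u0 w0 orth.
have [_ _ _ mmin] := principal_pairsS_minimizing jA jB.
rewrite /psi_ /= last_rcons; apply: (mmin (u, w)); split=> // q qs.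
have [q1 q2 _] := principal_pairs_common jAB qs.
by rewrite dotpC (orth _ q1).1 dotpC (orth _ q2).2.
Qed.

End SharedSubspace.

(** * Local Lipschitz bound for the determinant *)
Section Lipschitz.
Variables (R : realType) (m : nat) (N0 : 'M[R]_m).

(** Lipschitz at the point N0, for the sup norm and on the unit ball; the
    constant depends on N0 and on F only. *)
Let lipschitz (F : 'M[R]_m -> R) := exists2 C, 0 <= C &
  forall (N : 'M[R]_m) (eps : R), 0 <= eps <= 1 ->
    (forall i j, `|N i j - N0 i j| <= eps) -> `|F N - F N0| <= C * eps.

Let lipschitz_cst c : lipschitz (fun=> c).
Proof. by exists 0 => // N eps _ _; rewrite subrr normr0 mul0r. Qed.

Let lipschitzD F G : lipschitz F -> lipschitz G -> lipschitz (fun N => F N + G N).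
Proof.
move=> [C C0 FC] [D D0 GD]; exists (C + D); first exact: addr_ge0.
move=> N eps he hN; rewrite opprD addrACA mulrDl.
by apply: le_trans (ler_normD _ _) _; apply: lerD; [exact: FC|exact: GD].
Qed.

Let lipschitzM F G : lipschitz F -> lipschitz G -> lipschitz (fun N => F N * G N).
Proof.
move=> [C C0 FC] [D D0 GD]; exists (C * (`|G N0| + D) + `|F N0| * D).
  by rewrite addr_ge0 ?mulr_ge0 ?addr_ge0.
move=> N eps he hN; have := FC N eps he hN; have := GD N eps he hN.
have -> : F N * G N - F N0 * G N0
   = (F N - F N0) * G N + F N0 * (G N - G N0) by ring.
move=> hG hF; apply: le_trans (ler_normD _ _) _; rewrite !normrM.
have GN : `|G N| <= `|G N0| + D.
  have -> : G N = G N0 + (G N - G N0) by ring.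
  apply: le_trans (ler_normD _ _) _; rewrite lerD2l (le_trans hG)//.
  by case/andP: he => _ e1; rewrite ler_piMr.
rewrite mulrDl; apply: lerD.
  by rewrite mulrAC; apply: ler_pM.
by rewrite -mulrA; apply: ler_pM.
Qed.

Let lipschitz_big (op : R -> R -> R) x0 (I : Type) (r : seq I) (P : pred I) F :
  (forall F G, lipschitz F -> lipschitz G -> lipschitz (fun N => op (F N) (G N))) ->
  (forall i, lipschitz (F i)) ->
  lipschitz (fun N => \big[op/x0]_(i <- r | P i) F i N).
Proof.
move=> opL FL; elim: r => [|i r [C C0 IH]].
  by have [C C0 H] := lipschitz_cst x0; exists C => // N eps h1 h2; rewrite !big_nil; exact: H h1 h2.
have [C' C'0 H] : lipschitz (fun N =>
    if P i then op (F i N) (\big[op/x0]_(i <- r | P i) F i N)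
    else \big[op/x0]_(i <- r | P i) F i N).
  by case: (P i); [apply: opL => //; exists C|exists C].
by exists C' => // N eps h1 h2; rewrite !big_cons; exact: H h1 h2.
Qed.

(** The determinant is a polynomial in the entries, and this local Lipschitz
    property is stable under sums and products. *)
Lemma det_lipschitz : exists2 C, 0 <= C &
  forall (N : 'M[R]_m) (eps : R), 0 <= eps <= 1 ->
    (forall i j, `|N i j - N0 i j| <= eps) -> `|\det N - \det N0| <= C * eps.
Proof.
apply: lipschitz_big => [F G|s]; first exact: lipschitzD.
apply: lipschitzM; first exact: lipschitz_cst.
apply: lipschitz_big => [F G|i]; first exact: lipschitzM.
by exists 1 => // N eps _ H; rewrite mul1r.
Qed.

End Lipschitz.

(** * The subspaces spanned by a plane vector and coordinate vectors *)
Section Model.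
Variables (R : realType) (n k : nat).
Hypothesis hn : (k.+2 <= n)%N.
Notation V := 'rV[R]_n.

(** Rows x e_0 + y e_1, e_2, ..., e_(k+1) in R^n. *)
Definition model_mx (x y : R) : 'M[R]_(k.+1, n) := \matrix_(i, j)
  if i == ord0 then x * (j == 0 :> nat)%:R + y * (j == 1 :> nat)%:R
  else (j == i.+1 :> nat)%:R.

Definition model x y : {vspace V} := <<[tuple row i (model_mx x y) | i < k.+1]>>%VS.

Definition col0 : 'I_n := widen_ord hn ord0.
Definition col1 : 'I_n := widen_ord hn (lift ord0 ord0).
(** These two maps enumerate the columns 0, ..., k+1 except column 1, resp.
    column 0; the corresponding minors of the model matrix are x and y. *)
Definition omit1 (i : 'I_k.+1) : 'I_n := widen_ord hn (lift (lift ord0 ord0) i).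
Definition omit0 (i : 'I_k.+1) : 'I_n := widen_ord hn (lift ord0 i).

Lemma omit_increasing (h : 'I_k.+2) :
  exists f : minor_index n k.+1, val f =1 fun i => widen_ord hn (lift h i).
Proof.
have P : [forall i : 'I_k.+1, forall j : 'I_k.+1, (i < j)%N ==>
   ([ffun i => widen_ord hn (lift h i)] i < [ffun i => widen_ord hn (lift h i)] j)%N].
  apply/forallP => i; apply/forallP => j; apply/implyP => ij.
  by rewrite !ffunE /= /bump; lia.
by exists (Sub [ffun i => widen_ord hn (lift h i)] P) => i; rewrite SubK ffunE.
Qed.

Lemma det_omit1 x y : \det (colsub omit1 (model_mx x y)) = x.
Proof.
have -> : colsub omit1 (model_mx x y) = diag_mx (\row_i if i == ord0 then x else 1).
  apply/matrixP => -[[|i] hi] [[|j] hj]; rewrite !mxE //=.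
  - by rewrite !mulr1n mulr1 mulr0 addr0.
  - by rewrite mulr0 mulr0 addr0.
  by rewrite -!val_eqE /= /bump /= add1n eqSS eq_sym; case: eqP.
rewrite det_diag big_ord_recl big1 ?mulr1 ?mxE// => i _.
by rewrite mxE.
Qed.

Lemma det_omit0 x y : \det (colsub omit0 (model_mx x y)) = y.
Proof.
have -> : colsub omit0 (model_mx x y) = diag_mx (\row_i if i == ord0 then y else 1).
  apply/matrixP => -[[|i] hi] [[|j] hj]; rewrite !mxE //=.
  - by rewrite mulr1n mulr1 mulr0 add0r.
  - by rewrite mulr0 mulr0 addr0.
  by rewrite -!val_eqE /= /bump /= add1n eqSS eq_sym; case: eqP.
rewrite det_diag big_ord_recl big1 ?mulr1 ?mxE// => i _.
by rewrite mxE.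
Qed.

Lemma model_basis x y : x != 0 ->
  basis_of (model x y) [tuple row i (model_mx x y) | i < k.+1].
Proof.
move=> x0; rewrite /basis_of eqxx /=.
by apply: (@minor_free _ _ _ _ omit1); rewrite det_omit1.
Qed.

Lemma dim_model x y : x != 0 -> \dim (model x y) = k.+1.
Proof. by move=> /(model_basis y) /size_basis. Qed.

Lemma row_in_model x y i : row i (model_mx x y) \in model x y.
Proof. by apply/memv_span/mapP; exists i; rewrite ?mem_enum. Qed.

Lemma model_coords x y v : v \in model x y ->
  exists a, v 0 col0 = a * x /\ v 0 col1 = a * y.
Proof.
move=> /span_rowsP[u ->]; exists (u 0 ord0).
by split; rewrite mxE big_ord_recl big1 ?addr0 => [|i _]; rewrite mxE/= ?mulr0//;
   rewrite ?mulr1 ?mulr0 ?addr0 ?add0r.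
Qed.

Lemma dotp_row0 x y v :
  dotp v (row ord0 (model_mx x y)) = v 0 col0 * x + v 0 col1 * y.
Proof.
rewrite /dotp (bigD1 col0)//= (bigD1 col1)//= big1 ?addr0 => [|j /andP[j0 j1]].
  by rewrite !mxE/= !mulr1 !mulr0 addr0 add0r.
move: j0 j1; rewrite -!val_eqE/= => /negPf j0 /negPf j1.
by rewrite !mxE/= j0 [_ == 1%N]j1 !mulr0 addr0 mulr0.
Qed.

Lemma model_cap_orthogonal x y x' y' v : x * y' != y * x' ->
  v \in (model x y :&: model x' y')%VS ->
  dotp v (row ord0 (model_mx x y)) = 0 /\ dotp v (row ord0 (model_mx x' y')) = 0.
Proof.
move=> D /memv_capP[/model_coords[a [a0 a1]] /model_coords[b [b0 b1]]].
have aD : a * (x * y' - y * x') = 0.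
  rewrite mulrBr !mulrA -a0 -a1 b0 b1; ring.
move/eqP: aD; rewrite mulf_eq0 subr_eq0 (negPf D) orbF => /eqP aE.
by rewrite !dotp_row0 a0 a1 aE !mul0r addr0.
Qed.

(** The two subspaces share e_2, ..., e_(k+1), so their sum is generated by the
    first one and a single vector. *)
Lemma dim_model_cap x y x' y' : x != 0 -> x' != 0 ->
  (k <= \dim (model x y :&: model x' y'))%N.
Proof.
move=> x0 x'0; set A := model x y; set B := model x' y'.
pose w := row ord0 (model_mx x' y').
have BA : (A + B <= A + <[w]>)%VS.
  rewrite subv_add addvSl /=; apply/span_subvP => _ /mapP[i _ ->].
  have [->|i0] := eqVneq i ord0; first by rewrite (subvP (addvSr _ _)) ?memv_line.
  apply: (subvP (addvSl _ _)).
  rewrite (_ : row i _ = row i (model_mx x y)) ?row_in_model//.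
  by apply/rowP => j; rewrite !mxE (negPf i0).
have := dimv_sum_cap A B; rewrite !dim_model// => E.
have Bd : (\dim (A + B) <= k.+2)%N.
  apply: leq_trans (dimvS BA) _; apply: leq_trans (dimv_add_leqif _ _) _.
  by rewrite dim_model// dim_vline; case: (w != 0); lia.
by move: E Bd; move: (\dim (A + B)) (\dim (A :&: B)) => a b; lia.
Qed.

(** The two plane vectors are orthogonal to the intersection, so they bound the
    last angle; the sine of the angle between them is at most the distance of
    the two slopes. *)
Lemma psi_model_le (y : R) (p q : int) : 0 < q -> y != p%:~R / q%:~R ->
  psi_ k.+1 (model 1 y) (model q%:~R p%:~R) <= `|y - p%:~R / q%:~R|.
Proof.
move=> q0 yr; have qr : 0 < q%:~R :> R by rewrite ltr0z.
set u := row ord0 (model_mx 1 y); set w := row ord0 (model_mx q%:~R p%:~R).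
have u0 : u 0 col0 = 1 by rewrite !mxE/= mulr1 mulr0 addr0.
have u1 : u 0 col1 = y by rewrite !mxE/= mulr1 mulr0 add0r.
have w0 : w 0 col0 = q%:~R by rewrite !mxE/= mulr1 mulr0 addr0.
have w1 : w 0 col1 = p%:~R by rewrite !mxE/= mulr1 mulr0 add0r.
have un : 1 <= enorm u by have := coord_le_enorm u col0; rewrite u0 normr1.
have wn : q%:~R <= enorm w.
  by have := coord_le_enorm w col0; rewrite w0 gtr0_norm.
have uw : psi_ k.+1 (model 1 y) (model q%:~R p%:~R) <= psi u w.
  apply: psi_le_orthogonal_cap.
  - by apply: dim_model_cap; rewrite ?oner_eq0 ?gt_eqF.
  - by rewrite dim_model ?oner_eq0.
  - by rewrite dim_model ?gt_eqF.
  - exact: row_in_model.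
  - exact: row_in_model.
  - by rewrite -enorm_gt0 (lt_le_trans ltr01).
  - by rewrite -enorm_gt0 (lt_le_trans qr).
  move=> v; apply: model_cap_orthogonal.
  by apply: contraNneq yr; rewrite mul1r => ->; rewrite mulfK// gt_eqF.
apply: le_trans uw _; rewrite /psi wedge_normE.
rewrite !dotp_row0 u0 u1 w0 w1.
have -> : (1 * 1 + y * y) * (q%:~R * q%:~R + p%:~R * p%:~R) -
    (1 * q%:~R + y * p%:~R) ^+ 2 = (y * q%:~R - p%:~R) ^+ 2 :> R by ring.
rewrite sqrtr_sqr ler_pdivrMr; last by rewrite mulr_gt0//; lra.
have -> : y * q%:~R - p%:~R = (y - p%:~R / q%:~R) * q%:~R.
  by rewrite mulrBl divfK// gt_eqF.
rewrite normrM (gtr0_norm qr) ler_wpM2l//.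
by rewrite -[q%:~R]mul1r; apply: ler_pM => //; lra.
Qed.

End Model.

(** * Rational subspaces close to the model subspace *)
Section ModelApproximation.
Variables (R : realType) (n k : nat).
Hypothesis hn : (k.+2 <= n)%N.
Notation model := (@model R n k).
Notation model_mx := (@model_mx R n k).

(** Each product in the Leibniz expansion of a minor contains one entry of row
    0, at most q, and otherwise entries 0 or 1. *)
Lemma height_model : exists2 K : R, 0 < K & forall p q : int, 0 < q -> 0 <= p <= q ->
  rational_subspace (model q%:~R p%:~R) /\ height (model q%:~R p%:~R) <= K * q%:~R.
Proof.
exists (Num.sqrt #|minor_index n k.+1|%:R * #|{perm 'I_k.+1}|%:R).
  rewrite mulr_gt0 ?sqrtr_gt0 ?ltr0n//; last by apply/card_gt0P; exists 1%g.
  by apply/card_gt0P; have [f _] := omit_increasing hn ord0; exists f.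
move=> p q q0 pq; have qr : 1 <= q%:~R :> R by rewrite -[1]/(1%:~R) ler_int.
pose Z : 'M[int]_(k.+1, n) := \matrix_(i, j)
  if i == ord0 then q * (j == 0 :> nat)%:R + p * (j == 1 :> nat)%:R
  else (j == i.+1 :> nat)%:R.
have ZE i j : model_mx q%:~R p%:~R i j = (Z i j)%:~R.
  by rewrite !mxE; case: ifP => _; rewrite ?rmorphD ?rmorphM /= !rmorph_nat.
have qn : q%:~R != 0 :> R by rewrite gt_eqF//; lra.
have Mb := model_basis hn p%:~R qn.
have ratB : rational_subspace (model q%:~R p%:~R).
  exists [tuple row i (model_mx q%:~R p%:~R) | i < k.+1] => //.
  move=> _ /mapP[i _ ->] j; exists (Z i j)%:~R.
  by rewrite mxE ZE ratr_int.
split=> //; rewrite -mulrA.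
apply: (height_le_integral (N := fun f => \det (colsub (val f) Z)) ratB Mb).
- move=> f; rewrite -det_map_mx; congr (\det _).
  by apply/matrixP => i j; rewrite [LHS]mxE ZE !mxE.
- by rewrite mulr_ge0//; lra.
move=> f; rewrite -det_map_mx /determinant.
apply: le_trans (ler_norm_sum _ _ _) _.
rewrite mulr_natl -sumr_const; apply: ler_sum => s _.
rewrite normrM normrX normrN1 expr1n mul1r normr_prod.
have -> : q%:~R = \prod_(i < k.+1) (if i == ord0 then q%:~R else 1 : R).
  by rewrite big_ord_recl big1 ?mulr1.
apply: ler_prod => i _; rewrite normr_ge0 /= !mxE.
have pr : `|p%:~R| <= q%:~R :> R.
  by rewrite -intr_norm ler_int; case/andP: pq => p0 pq'; rewrite ger0_norm.
have pr0 : 0 <= q%:~R :> R by lra.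
case: ifP => _; last by case: eqP => _; rewrite ?normr1 ?normr0.
case: eqP => [->|_]; last rewrite mulr0 add0r.
  by rewrite mulr1 mulr0 addr0 ger0_norm.
by case: eqP => _; rewrite ?mulr1 // mulr0 normr0.
Qed.

(** If vectors Y of B are close to the rows of the model matrix, then the minors
    of Y along omit1 and omit0 are close to 1 and alpha.  They are a common
    multiple of two Pluecker coordinates q and p of B, so p / q is close to
    alpha, and q is at most the height of B. *)
Lemma rational_near_model (alpha : R) : 0 <= alpha <= 1 ->
  exists C delta : R, [/\ 0 <= C, 0 < delta &
    forall (B : {vspace 'rV[R]_n}) (Y : 'M[R]_(k.+1, n)) (eps : R),
    rational_subspaces k.+1 B -> (forall i, row i Y \in B) ->
    0 <= eps <= delta -> (forall i j, `|Y i j - model_mx 1 alpha i j| <= eps) ->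
    exists p q : int, [/\ 0 < q, q%:~R <= height B &
                          `|alpha - p%:~R / q%:~R| <= C * eps]].
Proof.
move=> /andP[a0 a1].
have [C1 C10 L1] := det_lipschitz (colsub (omit1 hn) (model_mx 1 alpha)).
have [C2 C20 L2] := det_lipschitz (colsub (omit0 hn) (model_mx 1 alpha)).
rewrite det_omit1 in L1; rewrite det_omit0 in L2.
pose C := C1 + C2 + 1; have C0 : 1 <= C by rewrite /C; lra.
exists (2 * C), (1 / (2 * C)); split; [lra|by rewrite divr_gt0//; lra|].
move=> B Y eps [rB dB] YB /andP[e0 e1] YM.
have e1' : C * eps <= 1 / 2.
  by move: e1; rewrite ler_pdivlMr; [lra|lra].
have e01 : 0 <= eps <= 1.
  have : eps <= C * eps by rewrite ler_peMl.
  by rewrite e0; lra.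
have [Xi [[M [c [Mb c0 Mm]]] _] ->] := height_spec rB dB.
have [T YE] := basis_rows_factor Mb YB.
have [f1 f1E] := omit_increasing hn (lift ord0 ord0).
have [f2 f2E] := omit_increasing hn ord0.
have YXi (f : minor_index n k.+1) : \det (colsub (val f) Y) = \det T * c * (Xi f)%:~R.
  by rewrite YE -mulmx_colsub det_mulmx Mm mulrA.
have {L1} := L1 (colsub (omit1 hn) Y) eps e01.
have {L2} := L2 (colsub (omit0 hn) Y) eps e01.
(* delta is chosen so that the minor close to 1 is at least 1/2. *)
rewrite -(eq_colsub _ f1E) -(eq_colsub _ f2E) !YXi.
set t := \det T * c => L2 L1.
have {}L1 : `|t * (Xi f1)%:~R - 1| <= C1 * eps.
  by apply: L1 => i j; rewrite !mxE f1E; have := YM i (omit1 hn j); rewrite !mxE.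
have {}L2 : `|t * (Xi f2)%:~R - alpha| <= C2 * eps.
  by apply: L2 => i j; rewrite !mxE f2E; have := YM i (omit0 hn j); rewrite !mxE.
move: (coord_le_l2norm (fun f => (Xi f)%:~R : R) f1); set H := Num.sqrt _ => HXi.
have CE : C * eps = C1 * eps + C2 * eps + eps by rewrite /C; ring.
have C1e : 0 <= C1 * eps by rewrite mulr_ge0.
have C2e : 0 <= C2 * eps by rewrite mulr_ge0.
have D1 : 1 / 2 <= t * (Xi f1)%:~R by move: L1; rewrite ler_norml => /andP[]; lra.
have X0 : Xi f1 != 0 by apply: contraTneq D1 => ->; rewrite mulr0 -ltNge; lra.
have t0 : t != 0 by apply: contraTneq D1 => ->; rewrite mul0r -ltNge; lra.
exists (Num.sg (Xi f1) * Xi f2), `|Xi f1|; split; first by rewrite normr_gt0.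
  by rewrite intr_norm.
have -> : (Num.sg (Xi f1) * Xi f2)%:~R / `|Xi f1|%:~R = (Xi f2)%:~R / (Xi f1)%:~R :> R.
  have s0 : (Num.sg (Xi f1))%:~R != 0 :> R by rewrite intr_eq0 sgr_eq0.
  by rewrite normrEsg !intrM invfM mulrACA divff// mul1r.
set X1 : R := (Xi f1)%:~R in D1 L1 *; set X2 : R := (Xi f2)%:~R in L2 *.
have X10 : X1 != 0 by rewrite intr_eq0.
have D0 : 0 < t * X1 by lra.
have -> : alpha - X2 / X1 = (alpha * (t * X1 - 1) - (t * X2 - alpha)) / (t * X1).
  by field; rewrite t0 X10.
rewrite normrM normfV (gtr0_norm D0) ler_pdivrMr//.
apply: le_trans (ler_normB _ _) _; rewrite normrM (ger0_norm a0).
have a1n : alpha * `|t * X1 - 1| <= C1 * eps.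
  by apply: le_trans L1; rewrite ler_piMl.
have : C * eps <= 2 * C * eps * (t * X1).
  have -> : 2 * C * eps * (t * X1) = C * eps * (2 * (t * X1)) by ring.
  by rewrite ler_peMr//; lra.
lra.
Qed.

End ModelApproximation.

(** * The exponent of the model subspace *)
Lemma powR_le_root (R : realType) (x y c : R) : 0 < y -> 0 <= x -> x `^ y <= c -> x <= c `^ y^-1.
Proof.
move=> y0 x0 xc; rewrite -[leLHS](powRr1 x0) -(mulfV (lt0r_neq0 y0)) powRrM.
by apply: ge0_ler_powR; rewrite ?nnegrE ?powR_ge0 ?invr_ge0 ?(ltW y0)// (le_trans _ xc)// powR_ge0.
Qed.

Section Exponent.
Variables (R : realType) (n k : nat).
Hypothesis hn : (k.+2 <= n)%N.
Variables (e : nat -> R) (alpha : R) (p q : nat -> int).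
Hypothesis alpha01 : 0 <= alpha <= 1.
Hypothesis alpha_irr : forall a b : int, 0 < b -> alpha != a%:~R / b%:~R.
Hypothesis convergents : forall i, [/\ i%:Z < q i, 0 <= p i <= q i
  & `|alpha - (p i)%:~R / (q i)%:~R| <= 2 * (q i)%:~R `^ (- e i)].
Hypothesis convergents_lt : forall i j, (i < j)%N ->
  (p i)%:~R / (q i)%:~R < (p j)%:~R / (q j)%:~R :> R.

Let A : {vspace 'rV[R]_n} := model n k 1 alpha.
Let dimA : \dim A = k.+1. Proof. by rewrite dim_model ?oner_eq0. Qed.

(** Otherwise A itself would be rational, and rational_near_model with Y the
    model matrix and eps = 0 would make alpha rational. *)
Lemma model_irrational : irrational_subspaces R n k.+1 k.+1 k.+1 A.
Proof.
split=> // B [rB dB]; rewrite ltnNge; apply/negP => dAB.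
have AB : (A <= B)%VS.
  have : (A :&: B)%VS == A by rewrite eqEdim capvSl dimA.
  by move/eqP <-; exact: capvSr.
have [C [delta [C0 delta0 H]]] := rational_near_model hn alpha01.
have [|i|||a [b [b0 _ ab]]] := H B (model_mx n k 1 alpha) 0.
- by split.
- by apply: (subvP AB); exact: row_in_model.
- by rewrite lexx ltW.
- by move=> i j; rewrite subrr normr0.
have := alpha_irr a b0; rewrite -subr_eq0 -normr_le0.
by rewrite (le_trans ab)// mulr0.
Qed.

Lemma q_gt0 i : 0 < q i. Proof. by have [] := convergents i; lia. Qed.

Let Bc i : {vspace 'rV[R]_n} := model n k (q i)%:~R (p i)%:~R.

Lemma model_convergent_inj : injective Bc.
Proof.
move=> i j E; wlog ij : i j E / (i < j)%N.
  by move=> W; case: (ltngtP i j) => // [/W|ji]; [exact|apply/esym/W].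
have qr m : (q m)%:~R != 0 :> R by rewrite intr_eq0 gt_eqF ?q_gt0.
have := convergents_lt ij.
have : row ord0 (model_mx n k (q i)%:~R (p i)%:~R) \in Bc j.
  by rewrite -E; exact: row_in_model.
move=> /(model_coords hn)[a]; rewrite !mxE /= !mulr1 !mulr0 addr0 add0r => -[qa pa].
have a0 : a != 0 by apply: contraTneq (qr i) => a0; rewrite qa a0 mul0r eqxx.
by rewrite qa pa -mulf_div divff// mul1r ltxx.
Qed.

(** The subspaces attached to the convergents have height at most K q_i and make
    an angle at most 2 q_i ^ (- e_i) with A; the margin eta absorbs the
    constants 2 and K once q_i ^ eta >= 2 K ^ gamma. *)
Lemma infinite_approximations (gamma eta : R) (i0 : nat) : 0 < gamma -> 0 < eta ->
  (forall i, (i0 <= i)%N -> gamma + eta <= e i) ->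
  infinite_set [set B | rational_subspaces k.+1 B /\
                        psi_ k.+1 A B <= height B `^ (- gamma)].
Proof.
move=> g0 eta0 eta_e; have [K K0 HK] := height_model R hn.
pose t := Num.truncn ((2 * K `^ gamma) `^ eta^-1); pose i1 := (i0 + t)%N.
move=> fin.
have := @finite_preimage _ _ _ (fun i => Bc (i + i1)%N) _ fin.
rewrite (_ : _ @^-1` _ = setT) => [H|].
  by apply: infinite_nat; apply: H => i j _ _ /model_convergent_inj /addIn.
apply/seteqP; split=> // i0' _ /=; set i := (i0' + i1)%N.
have [qi pi happrox] := convergents i.
have q0 := q_gt0 i.
have qr : 1 <= (q i)%:~R :> R by rewrite -[1]/(1%:~R) ler_int.
have qr0 : 0 < (q i)%:~R :> R by lra.
have [rB hB] := HK _ _ q0 pi.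
split; first by split=> //; rewrite dim_model// gt_eqF.
have h1 := height_ge1 rB.
apply: le_trans (psi_model_le hn q0 (alpha_irr _ q0)) _.
apply: le_trans happrox _.
apply: (@le_trans _ _ ((K * (q i)%:~R) `^ (- gamma))); last first.
  rewrite !powRN lef_pV2 ?posrE ?powR_gt0 ?mulr_gt0//; last by lra.
  by apply: ge0_ler_powR; rewrite ?nnegrE ?mulr_ge0 ?(ltW g0)//; lra.
have Kg : 0 < K `^ gamma by rewrite powR_gt0.
have qg : 0 < (q i)%:~R `^ gamma :> R by rewrite powR_gt0.
rewrite !powRN powRM ?(ltW K0) ?(ltW qr0)// ler_pdivrMr ?powR_gt0//.
rewrite mulrC ler_pdivlMr ?mulr_gt0//.
apply: (@le_trans _ _ ((q i)%:~R `^ (gamma + eta))); last first.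
  by apply: ler_powR => //; apply: eta_e; exact: leq_trans (leq_addr t i0) (leq_addl _ _).
rewrite powRD; last by apply/implyP => _; rewrite gt_eqF.
rewrite mulrA mulrC ler_pM2l//.
have c0 : 0 <= 2 * K `^ gamma by rewrite mulr_ge0 ?ltW.
have -> : 2 * K `^ gamma = ((2 * K `^ gamma) `^ eta^-1) `^ eta.
  by rewrite -powRrM mulVf ?lt0r_neq0// powRr1.
apply: ge0_ler_powR; rewrite ?nnegrE ?powR_ge0 ?(ltW eta0) ?(ltW qr0)//.
apply: le_trans (ltW (truncnS_gt _)) _.
suff : (t.+1%:Z)%:~R <= (q i)%:~R :> R by [].
have ti : (t <= i)%N by exact: leq_trans (leq_addl i0 t) (leq_addl _ _).
by rewrite ler_int; clear -ti qi; lia.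
Qed.

Lemma mu_infinite : (forall i, i%:R <= e i) -> mu k.+1 k.+1 A = +oo%E.
Proof.
move=> ei; apply: eq_infty => r.
pose g := Num.max r 1; have g1 : 1 <= g by rewrite le_max lexx orbT.
apply: (@le_trans _ _ g%:E); first by rewrite lee_fin le_max lexx.
apply: ereal_sup_ubound; exists g => //; split; first by lra.
apply: (@infinite_approximations g 1 (Num.truncn (g + 1)).+1) => // [|i ii].
  by lra.
apply: le_trans (ei i); apply: le_trans (ltW (truncnS_gt _)) _.
by rewrite ler_nat.
Qed.

Lemma enorm_row_model i : enorm (row i (model_mx n k 1 alpha)) <= 2.
Proof.
rewrite -[leRHS](ger0_norm (ler0n R 2)) -sqrtr_sqr; apply: ler_wsqrtr.
have [->|i0] := eqVneq i ord0.
  rewrite (dotp_row0 hn) !mxE/= !mulr1 !mulr0 addr0 add0r.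
  by case/andP: alpha01 => a0 a1; nra.
rewrite /dotp.
have hi : (i.+1 < n)%N by have := ltn_ord i; lia.
rewrite (bigD1 (Ordinal hi))//= big1 => [|j ji].
  by rewrite !mxE (negPf i0) /= eqxx mulr1n; lra.
rewrite !mxE (negPf i0); move: ji; rewrite -val_eqE /= => /negPf ->.
by rewrite mul0r.
Qed.

(** Either the angle is bounded below, or B provides a fraction a / c with
    c <= H(B) whose distance to alpha is at most a constant times the angle,
    while it is at least H(B) ^ (- b) / 8.  Both cases bound H(B), and
    northcott applies. *)
Lemma finite_approximations (b gamma : R) : 2 <= b -> b < gamma ->
  (forall a c : int, 0 < c -> 1 / 8 * c%:~R `^ (- b) <= `|alpha - a%:~R / c%:~R|) ->
  finite_set [set B | rational_subspaces k.+1 B /\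
                      psi_ k.+1 A B <= height B `^ (- gamma)].
Proof.
move=> b2 bg bad.
have [C [delta [C0 delta0 near]]] := rational_near_model hn alpha01.
pose L : R := k.+1%:R * 2; have L0 : 0 < L by rewrite /L mulr_gt0 ?ltr0n.
pose K1 := L / delta; pose K2 := (8 * C * L) `^ (gamma - b)^-1.
have K10 : 0 <= K1 by rewrite divr_ge0 ?ltW.
have K20 : 0 <= K2 by rewrite powR_ge0.
apply: (@sub_finite_set _ _ [set B | rational_subspaces k.+1 B /\ height B <= K1 + K2]);
  last exact: northcott.
move=> B [[rB dB] psiB]; split=> //.
have h1 := height_ge1 rB; set H := height B in psiB h1 *.
have H0 : 0 < H by lra.
have psi0 : 0 <= psi_ k.+1 A B by exact: psi_ge0.
have Hg : 0 < H `^ gamma by rewrite powR_gt0.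
have psiH : psi_ k.+1 A B * H `^ gamma <= 1.
  by rewrite -ler_pdivlMr// mul1r -powRN.
have [small|large] := lerP (L * psi_ k.+1 A B) delta; last first.
  have HHg : H <= H `^ gamma by apply: le1r_powR => //; lra.
  suff : H <= K1 by lra.
  rewrite /K1 ler_pdivlMr// mulrC.
  apply: (@le_trans _ _ (delta * H `^ gamma)); first by rewrite ler_pM2l.
  apply: (@le_trans _ _ (L * psi_ k.+1 A B * H `^ gamma)).
    by rewrite ler_pM2r// ltW.
  by rewrite -mulrA -[leRHS]mulr1 ler_pM2l.
have /choice[Y YP] : forall i, exists Y, Y \in B /\
    forall j, `|row i (model_mx n k 1 alpha) 0 j - Y 0 j| <= L * psi_ k.+1 A B.
  move=> i; have [Y YB HY] := approx_by_psi dimA dB (row_in_model n 1 alpha i).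
  exists Y; split=> // j; apply: le_trans (HY j) _.
  rewrite ler_wpM2r// /L ler_pM2l ?ltr0n//.
  exact: enorm_row_model.
have [||i j|a [c [c0 cH ac]]] :=
  near B (\matrix_i Y i) (L * psi_ k.+1 A B) (conj rB dB).
- by move=> i; rewrite rowK; have [] := YP i.
- by rewrite small mulr_ge0// ltW.
- by rewrite distrC; have [_ /(_ j)] := YP i; rewrite !mxE.
suff : H <= K2 by lra.
have cr : 1 <= c%:~R :> R by rewrite -[1]/(1%:~R) ler_int.
have c0r : 0 < c%:~R :> R by lra.
apply: powR_le_root; [lra|lra|].
rewrite powRB; last by apply/implyP => _; rewrite gt_eqF.
have Hb : 0 < H `^ b by rewrite powR_gt0.
rewrite ler_pdivrMr//.
have cb : c%:~R `^ b <= H `^ b by apply: ge0_ler_powR; rewrite ?nnegrE//; lra.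
have cb0 : 0 < c%:~R `^ b :> R by rewrite powR_gt0.
have := le_trans (bad a c c0) ac.
rewrite powRN ler_pdivrMr// => bound.
have CL0 : 0 <= C * L by rewrite mulr_ge0// ltW.
have h : 1 <= 8 * (C * (L * psi_ k.+1 A B)) * H `^ b.
  have : C * (L * psi_ k.+1 A B) * c%:~R `^ b <= C * (L * psi_ k.+1 A B) * H `^ b.
    by rewrite ler_wpM2l// mulrA mulr_ge0.
  lra.
rewrite -[leLHS]mul1r.
apply: (@le_trans _ _ (8 * (C * (L * psi_ k.+1 A B)) * H `^ b * H `^ gamma)).
  by rewrite ler_pM2r.
have -> : 8 * (C * (L * psi_ k.+1 A B)) * H `^ b * H `^ gamma
  = (8 * C * L * H `^ b) * (psi_ k.+1 A B * H `^ gamma) by ring.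
by rewrite -[leRHS]mulr1 ler_wpM2l// -mulrA -mulrA !mulr_ge0// ltW.
Qed.

Lemma mu_finite (b : R) : 2 <= b -> (forall i, e i = b) ->
  (forall a c : int, 0 < c -> 1 / 8 * c%:~R `^ (- b) <= `|alpha - a%:~R / c%:~R|) ->
  mu k.+1 k.+1 A = b%:E.
Proof.
move=> b2 eb bad; apply/eqP; rewrite eq_le; apply/andP; split.
  apply: ge_ereal_sup => _ [g [g0 inf] <-]; rewrite lee_fin leNgt; apply/negP => bg.
  by apply: inf; exact: finite_approximations bad.
apply/lee_subgt0Pr => eps eps0.
pose g := Num.max (b - eps) 1; have g1 : 1 <= g by rewrite le_max lexx orbT.
have gb : g < b by rewrite gt_max; apply/andP; split; lra.
apply: (@le_trans _ _ g%:E); first by rewrite -EFinB lee_fin le_max lexx.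
apply: ereal_sup_ubound; exists g => //; split; first by lra.
apply: (@infinite_approximations g (b - g) 0) => [||i _]; [lra|lra|].
by rewrite eb; lra.
Qed.

End Exponent.

Unset Implicit Arguments.
Set Strict Implicit.

Theorem mainTheorem8 (R : realType) (n l : nat) (hn : (2 <= n)%N)
    (hl : (1 <= l <= n./2)%N) :
  `[(1 + 1 / (2 * l%:R) + Num.sqrt (1 + 1 / (4 * l%:R ^+ 2)) : R)%:E, +oo%E]
    `<=` [set mu l l A | A in irrational_subspaces R n l l l].
Proof.
move=> beta; rewrite /= in_itv /= => /andP[beta_ge _].
case: l hl beta_ge => [//|k] hl beta_ge.
have hkn : (k.+2 <= n)%N by lia.
case: beta beta_ge => [b|_|//].
  rewrite lee_fin => b_ge.
  have b2 : 2 <= b.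
    apply: le_trans b_ge.
    have le1 : 1 <= Num.sqrt (1 + 1 / (4 * k.+1%:R ^+ 2)) :> R.
      by rewrite -[leLHS]sqrtr1 ler_wsqrtr// lerDl divr_ge0 ?mulr_ge0 ?sqr_ge0 ?ler0n.
    have ge0 : 0 <= 1 / (2 * k.+1%:R) :> R by rewrite divr_ge0 ?mulr_ge0 ?ler0n.
    by rewrite (_ : 2 = 1 + 0 + 1); [rewrite !lerD|ring].
  have [alpha [p [q [h1 h2 h3 h4 h5]]]] :=
    @exists_convergents R (fun=> b) (fun=> b2).
  exists (model n k 1 alpha); first exact: model_irrational.
  by apply: (mu_finite hkn h1 h2 h3 h4 b2) => //; exact: h5.
have e2 i : 2 <= i.+2%:R :> R by rewrite ler_nat.
have [alpha [p [q [h1 h2 h3 h4 h5]]]] := exists_convergents e2.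
exists (model n k 1 alpha); first exact: model_irrational.
by apply: (mu_infinite hkn h1 h2 h3 h4) => i; rewrite ler_nat; lia.
Qed.
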